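(* Let $\mathtt{c}$ be a cycle with vertex set $I$, viewed as an element of $\mathrm{C}[I]$. Then the antipode of $\mathrm{C}$ satisfies $$\mathbbm{s}_I(\mathtt{c})=\sum_{\pi\in PNC(\mathtt{c})}(-1)^{|\pi|}\,C_{(\overline{\pi}_+:\pi_+)}\,\mathtt{c}(\pi),$$ where $PNC(\mathtt{c})$ is the set of pointed noncrossing partitions of $\mathtt{c}$ and $|\pi|=1+|\pi_+|$; this expression is cancellation-free and grouping-free.
   Context: The Hopf monoid $\mathrm{C}$: $\mathrm{C}[I]$ is the set of (not necessarily simple) graphs on vertex set $I$ whose connected components are paths or cycles, a cycle on $m$ vertices having exactly $m$ edges (so cycles on 1 and 2 vertices have a loop, resp. a double edge). For $I=S\sqcup T$, the product of $g_1\in\mathrm{C}[S]$, $g_2\in\mathrm{C}[T]$ is $g_1\sqcup g_2$; the coproduct of $g\in\mathrm{C}[I]$ is $(g|_S,g/_S)$ with $g/_S=g:T$ the induced subgraph on $T$ and $g|_S$ the graph on $S$ with one edge between $u,v\in S$ for each $T$-thread, i.e. each walk along a path of $g$ (up to reversal) from $u$ to $v$ with all intermediate vertices in $T$ ($u=v$ allowed; distinct threads give distinct edges). The antipode is the collection of linear maps $\mathbbm{s}_I:\Bbbk\mathrm{C}[I]\to\Bbbk\mathrm{C}[I]$ with $\mathbbm{s}_\emptyset=\mathrm{id}$ and $\mathbbm{s}_I(x)=-\sum_{I=S\sqcup T,\,S\neq\emptyset}x|_S\cdot\mathbbm{s}_T(x/_S)$ for $I\ne\emptyset$. Pointed noncrossing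 partitions: for a cycle $\mathtt{c}=(i_1i_2\dots i_n)$, a pointed noncrossing partition is a pair $\pi=(\pi_0,\pi_+)$ such that $\{\pi_0\}\sqcup\pi_+$ is a noncrossing partition of the sequence $i_1,\dots,i_n$ (no $a,c$ in one block and $b,d$ in another appear in the order $a,b,c,d$); this notion does not depend on the chosen starting vertex. $\pi_0$ is the zero block, blocks of $\pi_+$ are nonzero blocks. For $\pi=(\pi_0,\{\pi_1,\dots,\pi_k\})$, $\mathtt{c}(\pi)=\mathtt{c}|_{\pi_0}\sqcup(\mathtt{c}/_{\pi_0})|_{\pi_1}\sqcup\dots\sqcup(\mathtt{c}/_{\pi_0})|_{\pi_k}$. Adjacent closure: write the cycle as $(i_1\dots i_n)$ with $i_1\in\pi_0$, and order vertices by $i_1<i_2<\dots<i_n$. $\overline{\pi}=(\pi_0,\overline{\pi}_+)$, where $\overline{\pi}_+$ is obtained from $\pi_+$ by successively merging two nonzero blocks $B,B'$ whenever the maximum of $B$ is immediately followed (in the sequence $i_1,\dots,i_n$) by the minimum of $B'$. Then $C_{(\overline{\pi}_+:\pi_+)}=\prod_{B\in\overline{\pi}_+}C_{m_B}$, where $m_B$ is the number of blocks of $\pi_+$ contained in $B$ and $C_m=\frac{1}{m+1}\binom{2m}{m}$ is the Catalan number. *)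

(* Defs.v *)
From HB Require Import structures.
From mathcomp Require Import all_boot all_order all_algebra.
From mathcomp Require Import finmap monalg.

Set Implicit Arguments.
Unset Strict Implicit.
Unset Printing Implicit Defensive.

Import GRing.Theory.
Local Open Scope ring_scope.

(* mult g e is the number of edges of g with end set e, where e = [set u; v] *)
(* is a singleton for a loop.                                                *)
Record mgraph (V : finType) :=
  MGraph { verts : {set V}; mult : {ffun {set V} -> nat} }.

Definition mgraph_pair (V : finType) (g : mgraph V) := (verts g, mult g).
Definition pair_mgraph (V : finType) gm : mgraph V := MGraph gm.1 gm.2.
Lemma mgraph_pairK (V : finType) : cancel (@mgraph_pair V) (@pair_mgraph V).
Proof. by case. Qed.
HB.instance Definition _ (V : finType) :=
  Choice.copy (mgraph V) (can_type (@mgraph_pairK V)).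

Section Multigraphs.
Variable V : finType.
Implicit Types (g : mgraph V) (S T I : {set V}) (e : {set V}).

Definition edgeless I : mgraph V := MGraph I [ffun=> 0%N].
Definition gunion g1 g2 : mgraph V :=
  MGraph (verts g1 :|: verts g2) [ffun e => (mult g1 e + mult g2 e)%N].

Lemma gunionA : associative gunion.
Proof.
move=> g1 g2 g3; congr MGraph; first exact: setUA.
by apply/ffunP=> e; rewrite !ffunE addnA.
Qed.

Lemma gunion0g : left_id (edgeless set0) gunion.
Proof.
case=> I m; congr MGraph; first exact: set0U.
by apply/ffunP=> e; rewrite !ffunE.
Qed.

Lemma gunionC : commutative gunion.
Proof.
move=> g1 g2; congr MGraph; first exact: setUC.
by apply/ffunP=> e; rewrite !ffunE addnC.
Qed.

Lemma guniong0 : right_id (edgeless set0) gunion.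
Proof. by move=> g; rewrite gunionC gunion0g. Qed.

Lemma gunion_eq0 g1 g2 :
  gunion g1 g2 = edgeless set0 -> g1 = edgeless set0 /\ g2 = edgeless set0.
Proof.
have eq0_l h1 h2 : gunion h1 h2 = edgeless set0 -> h1 = edgeless set0.
  case: h1 h2 => [I1 m1] [I2 m2] [/eqP].
  rewrite setU_eq0 => /andP[/eqP/= -> _] /ffunP eq0.
  congr MGraph; apply/ffunP=> e; have := eq0 e.
  by rewrite !ffunE => /eqP; rewrite addn_eq0 => /andP[/eqP].
by move=> eq0; split; [|rewrite gunionC in eq0]; apply: eq0_l eq0.
Qed.

End Multigraphs.

(* With this instance, the product of {malg K[mgraph V]} is the bilinear     *)
(* extension of disjoint union.                                              *)
HB.instance Definition _ (V : finType) := Choice_isMonomialDef.Build (mgraph V)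
  (@gunionA V) (@gunion0g V) (@guniong0 V) (@gunion_eq0 V).
HB.instance Definition _ (V : finType) :=
  MonomialDef_isConomialDef.Build (mgraph V) (@gunionC V).

Section PathsAndCycles.
Variable V : finType.
Implicit Types (g : mgraph V) (S T I : {set V}) (e : {set V}) (s : seq V).

Definition steps (x : V) (p : seq V) : seq {set V} :=
  pairmap (fun y z => [set y; z]) x p.

Definition path_edges s : seq {set V} :=
  if s is x :: p then steps x p else [::].

(* One edge per vertex: a loop if s = [:: x], a double edge if size s = 2.   *)
Definition cycle_edges s : seq {set V} :=
  if s is x :: p then steps x (rcons p x) else [::].

Definition path_graph s : mgraph V :=
  MGraph [set x in s] [ffun e => count_mem e (path_edges s)].

Definition cycle_graph s : mgraph V :=
  MGraph [set x in s] [ffun e => count_mem e (cycle_edges s)].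

(* A component is a vertex sequence, flagged by true if it is a cycle.       *)
Definition component (c : bool * seq V) : mgraph V :=
  if c.1 then cycle_graph c.2 else path_graph c.2.

(* g \in C[I] *)
Definition inC I g : Prop :=
  exists cs : seq (bool * seq V),
    [/\ all (fun c => c.2 != [::]) cs,
        uniq (flatten (unzip2 cs)),
        [set x in flatten (unzip2 cs)] = I
      & g = \big[mmul/mone]_(c <- cs) component c].

(* The edges of g, with parallel edges told apart. *)
Definition edge g : finType := {e : {set V} & 'I_(mult g e)}.

(* A walk x_0, ..., x_l along edges e_1, ..., e_l. The bounds on the lengths *)
(* lose nothing: the inner vertices of a thread are distinct and differ from *)
(* its ends.                                                                 *)
Definition walk g : finType := (#|V|.+1.-bseq V * #|V|.-bseq (edge g))%type.

Definition rev_walk g (w : walk g) : walk g :=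
  ([bseq of rev w.1], [bseq of rev w.2]).

(* w has at least one edge, end set e, inner vertices in T, and follows a    *)
(* path of g, or a cycle of g if its two ends are equal.                     *)
Definition is_thread g T e (w : walk g) : bool :=
  if (w.1 : seq V) is x :: p then
    let inner := behead (belast x p) in
    [&& p != [::], e == [set x; last x p],
        [seq tag f | f <- w.2] == steps x p,
        uniq w.2, uniq inner & all (mem T) inner]
  else false.

(* Walks up to reversal. *)
Definition threads g T e : {set {set walk g}} :=
  [set [set w; rev_walk w] | w in [set w | is_thread T e w]].

(* The coproduct of g \in C[I], for S \subset I and T = I :\: S, is          *)
(* (restr g S, contr g S).                                                   *)
Definition restr g S : mgraph V :=
  MGraph S
    [ffun e : {set V} =>
      if e \subset S then #|threads g (verts g :\: S) e| else 0%N].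

Definition contr g S : mgraph V :=
  MGraph (verts g :\: S)
    [ffun e : {set V} => if e \subset verts g :\: S then mult g e else 0%N].

End PathsAndCycles.

(* k C[I] is the span of the graphs of C[I] in the free module on all        *)
(* multigraphs. The conditions determine A I on k C[I]; the values of A I    *)
(* elsewhere are irrelevant.                                                 *)
Definition is_antipode (K : fieldType) (V : finType)
    (A : {set V} -> {linear {malg K[mgraph V]} -> {malg K[mgraph V]}}) : Prop :=
  (forall x : mgraph V, inC set0 x -> A set0 << x >> = << x >>) /\
  (forall (I : {set V}) (x : mgraph V), I != set0 -> inC I x ->
     A I << x >> =
       - \sum_(S : {set V} | (S \subset I) && (S != set0))
           << restr x S >> * A (I :\: S) << contr x S >>).

Lemma antipode_exists (K : fieldType) (V : finType) :
  exists A : {set V} -> {linear {malg K[mgraph V]} -> {malg K[mgraph V]}},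
    is_antipode A.
Proof.
pose M := {malg K[mgraph V]}.
pose lift (f : mgraph V -> M) (x : M) : M := \sum_(g <- msupp x) x@_g *: f g.
have liftw f (d : {fset mgraph V}) x : (msupp x `<=` d)%fset ->
    lift f x = \sum_(g <- d) x@_g *: f g.
  move=> le_d; apply: big_fset_incl => // g _ /mcoeff_outdom ->.
  by rewrite scale0r.
have lift_lin f : linear (lift f).
  move=> a x y; pose d := (msupp x `|` msupp y)%fset.
  rewrite !(liftw f d) ?fsubsetUl ?fsubsetUr //; last first.
    apply: fsubset_trans (msuppD_le _ _) _.
    exact/fsetSU/msuppZ_le.
  rewrite scaler_sumr -big_split; apply: eq_bigr => g _ /=.
  by rewrite mcoeffD mcoeffZ scalerDl scalerA.
pose L f : {linear M -> M} :=
  HB.pack (lift f) (GRing.isLinear.Build K M M *:%R (lift f) (lift_lin f)).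
have LU f g : L f << g >> = f g.
  rewrite /L /= (liftw f [fset g]%fset) ?msuppU_le //.
  by rewrite big_seq_fset1 mcoeffUU scale1r.
pose fix F n (I : {set V}) (x : mgraph V) {struct n} : M :=
  if n is n'.+1 then
    if I == set0 then << x >> else
    - \sum_(S : {set V} | (S \subset I) && (S != set0))
        << restr x S >> * F n' (I :\: S) (contr x S)
  else << x >>.
have F0 n x : F n set0 x = << x >> by case: n => //= n; rewrite eqxx.
have FS n (I : {set V}) x : I != set0 -> F n.+1 I x =
    - \sum_(S : {set V} | (S \subset I) && (S != set0))
        << restr x S >> * F n (I :\: S) (contr x S).
  by move=> /negPf IN0; rewrite [LHS]/= IN0.
clearbody L F.
have ltD (I S : {set V}) : S \subset I -> S != set0 -> (#|I :\: S| < #|I|)%N.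
  move=> sSI SN0; rewrite cardsD (setIidPr sSI) -subn_gt0.
  by rewrite subKn ?subset_leq_card ?card_gt0.
have FE m n (I : {set V}) x :
    (#|I| <= m)%N -> (#|I| <= n)%N -> F m I x = F n I x.
  have [->|IN0] := eqVneq I set0; first by rewrite !F0.
  elim: m n I x IN0 => [|m IHm] [|n] I x IN0;
    rewrite ?leqn0 ?cards_eq0 ?(negPf IN0) // => leIm leIn.
  rewrite (FS m I x IN0) (FS n I x IN0); apply: (congr1 -%R).
  apply: eq_bigr => S /andP[sSI SN0]; apply: (congr1 (GRing.mul _)).
  have [->|DN0] := eqVneq (I :\: S) set0; first by rewrite !F0.
  have ltI := ltD I S sSI SN0.
  by apply: IHm DN0 _ _; rewrite -ltnS; apply: leq_trans ltI _.
exists (fun I : {set V} => L (F #|I| I)); split=> [x _|I x IN0 _].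
  by rewrite LU F0.
have defI : #|I| = #|I|.-1.+1 by rewrite prednK ?card_gt0.
rewrite LU defI (FS _ I x IN0); apply: (congr1 -%R).
apply: eq_bigr => S /andP[sSI SN0]; rewrite LU; apply: (congr1 (GRing.mul _)).
by apply: FE; rewrite // -ltnS -defI; apply: ltD.
Qed.

Section PointedNoncrossing.
Variable V : finType.
Implicit Types (s : seq V) (B : {set V}) (P : {set {set V}}).

Definition noncrossing s P : bool :=
  [forall B in P, forall B' in P, (B != B') ==>
    [forall a in B, forall c in B, forall b in B', forall d in B',
      ~~ [&& index a s < index b s, index b s < index c s
           & index c s < index d s]]]%N.

(* (pi_0, pi_+); the blocks of a partition, pi_0 included, are nonempty.     *)
Definition pointed : finType := ({set V} * {set {set V}})%type.
Implicit Type p : pointed.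

Definition PNC s : {set pointed} :=
  [set p : pointed | [&& p.1 \notin p.2, partition (p.1 |: p.2) [set x in s]
                       & noncrossing s (p.1 |: p.2)]].

(* c(pi) for the cycle c on s. *)
Definition pnc_graph s p : mgraph V :=
  let c := cycle_graph s in
  mmul (restr c p.1) (\big[mmul/mone]_(B in p.2) restr (contr c p.1) B).

(* In t, the maximum of B is immediately followed by the minimum of B'.      *)
Definition followed_by (t : seq V) B B' : bool :=
  [exists x in B, exists y in B',
    [&& [forall z in B, index z t <= index x t],
        [forall z in B', index y t <= index z t]
      & index y t == (index x t).+1]]%N.

Definition merge_once (t : seq V) P : {set {set V}} :=
  if [pick BB : {set V} * {set V} |
        [&& BB.1 \in P, BB.2 \in P & followed_by t BB.1 BB.2]] is Some BB
  then (BB.1 :|: BB.2) |: (P :\ BB.1 :\ BB.2) else P.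

(* Each merge removes a block, so #|pi_+| rounds are enough. The sequence is *)
(* rotated to start in pi_0; the result does not depend on which vertex of   *)
(* pi_0 comes first.                                                         *)
Definition adjacent_closure s p : {set {set V}} :=
  iter #|p.2| (merge_once (rot (find (mem p.1) s) s)) p.2.

Definition catalan (m : nat) : nat := ('C(m.*2, m) %/ m.+1)%N.

Definition closure_catalan s p : nat :=
  (\prod_(B in adjacent_closure s p) catalan #|[set D in p.2 | D \subset B]|)%N.

Definition pnc_coef s p : int :=
  (-1) ^+ (1 + #|p.2|) * (closure_catalan s p)%:Z.

End PointedNoncrossing.

(* For an expression \sum_(i in D) a i * b i with basis elements b i.        *)
Definition cancellation_free (J : finType) (B : eqType)
    (D : {set J}) (a : J -> int) (b : J -> B) : Prop :=
  {in D &, forall i j, b i = b j -> 0 <= a i * a j}.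

Definition grouping_free (J : finType) (B : eqType)
    (D : {set J}) (a : J -> int) (b : J -> B) : Prop :=
  {in D, forall i, a i != 0} /\ {in D &, injective b}.

(* Main.v *)
(* Fix a sequence t and a subset U of it, and let F be the forest that the    *)
(* path on t induces on U. By induction on #|U|, the antipode of F is the sum *)
(* over all Q, consisting of a noncrossing partition of each component of F,  *)
(* of w(Q) times the product of the paths on the blocks of Q. Indeed the      *)
(* recursion removes some S and then partitions the rest by some P; the       *)
(* intersections of S with the components of F form a set X of blocks, and    *)
(* Q = X + P determines the product of graphs. So one needs that, for Q fixed *)
(* and X running over the removable sets of blocks, the w(Q - X) sum to 0.    *)
(* Now X is removable when it has at most one block in each component, each   *)
(* of them lying under no other block. In a given component the blocks under  *)
(* no other block are B_1, ..., B_m, where the maximum of each is followed by *)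
(* the minimum of the next: they form a maximal chain for the merging of      *)
(* adjacent blocks, which contributes the factor C_m to w. Removing B_j       *)
(* changes this factor into - C_(j-1) C_(m-j) and no other one, so that the   *)
(* sum vanishes by the recursion of the Catalan numbers.                      *)
(* For a cycle c, a nonempty S leaves such a forest, where t is c cut open at *)
(* a vertex of S, and the theorem is the first step of the recursion. Finally *)
(* c(pi) determines pi: the blocks are the components, and the zero block is  *)
(* the one that carries a cycle.                                              *)

Require Import Defs.
From mathcomp Require Import all_boot all_order all_algebra.
From mathcomp Require Import finmap monalg zify.
Set Implicit Arguments.
Unset Strict Implicit.
Unset Printing Implicit Defensive.
Import GRing.Theory.
Local Open Scope ring_scope.

(** The antipode recursion is solved on the forests that remain when a nonempty set is removed from
    the cycle; one more step then gives the cycle. In [forest_antipode] the values known by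
    induction turn the recursion into a double sum: over a family [Q] of blocks, which alone
    determines the product of graphs ([restr_forest_pieces], [restr_forest_local]), and over the
    subfamily [X] formed by the pieces of the removed set. The coefficient of [Q] vanishes by
    [removal_sum], for which one run suffices: its outermost blocks form a maximal chain
    ([outer_chain]), at most one of them is removed at a time, and its removal cuts the chain in
    two, so that the total is zero by the Catalan convolution ([weight_chain_removal]). The iterated
    merging in the definition of the coefficient is linked to chains by [closure_catalan_chains]:
    each block of the closure is the union of a maximal chain, and the maximal chains do not depend
    on the order of merging ([chains_prod]). For the cycle the removed set is the zero block:
    [contr_cycle] identifies what remains with a forest, and [PNCP] matches the partitions of that
    forest with the families of nonzero blocks. Distinct indices give distinct graphs by
    [pnc_graph_inj]: the blocks are recovered as connected components ([pnc_blocks_sub]), and the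
    zero block by counting threads ([pnc_zero_block]). *)

(** * Catalan numbers and their convolution *)

Lemma mul_catalan m : (m.+1 * catalan m = 'C(m.*2, m))%N.
Proof.
rewrite /catalan mulnC divnK //.
(* Since (m + 1) C(2m, m + 1) = m C(2m, m), the number m + 1 divides C(2m, m), and the division in
   [catalan] is exact. *)
have E : ('C(m.*2, m) + m.+1 * 'C(m.*2, m.+1) = m.+1 * 'C(m.*2, m))%N.
  by rewrite mul_bin_left -addnn addnK addnC; lia.
have /= := dvdn_addl 'C(m.*2, m) (dvdn_mulr 'C(m.*2, m.+1) (dvdnn m.+1)).
by rewrite E dvdn_mulr // => /esym.
Qed.

Lemma catalan_gt0 m : (0 < catalan m)%N.
Proof.
have : (0 < m.+1 * catalan m)%N.
  by rewrite mul_catalan bin_gt0 -addnn leq_addr.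
by rewrite muln_gt0.
Qed.

Lemma catalan0 : catalan 0 = 1%N.
Proof. by []. Qed.

Lemma catalan_rec m : (m.+2 * catalan m.+1 = (4 * m + 2) * catalan m)%N.
Proof.
have E1 := mul_catalan m; have E2 := mul_catalan m.+1.
have B1 := mul_bin_diag (m.*2).+1 m.
have B2 := mul_bin_down (m.*2).+1 m.
have B3 := binS (m.*2).+1 m.
rewrite doubleS in E2; rewrite -E2 in B3.
have E3 : 'C((m.*2).+1, m) = 'C((m.*2).+1, m.+1).
  by rewrite -bin_sub; [congr 'C(_, _); lia | lia].
rewrite E3 in B3; rewrite -E1 in B1.
move: B1 B3; set X := 'C(_.+1, m.+1) => B1 B3.
have B4 : (m.+1 * X = m.+1 * ((m.*2).+1 * catalan m))%N by rewrite -B1; nia.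
have {}B4 : X = ((m.*2).+1 * catalan m)%N.
  by apply/eqP; rewrite -(eqn_pmul2l (ltn0Sn m)) B4.
by rewrite B3 B4; lia.
Qed.

(* Symmetrizing i <-> n - i turns the weighted sum of (i + 1) C_i C_(n-i)    *)
(* into (n + 2) / 2 times the convolution, while catalan_rec reduces the     *)
(* weighted sum to the previous convolution.                                 *)
Lemma catalan_convolution n :
  (\sum_(i < n.+1) catalan i * catalan (n - i) = catalan n.+1)%N.
Proof.
elim: n => [|n IHn]; first by rewrite big_ord1.
pose G (i : nat) := (catalan i * catalan (n.+1 - i))%N.
have sym : (\sum_(i < n.+2) i.+1 * G i = \sum_(i < n.+2) (n.+1 - i).+1 * G i)%N.
  rewrite (reindex_inj rev_ord_inj) /=; apply: eq_bigr => i _.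
  have -> : (n.+2 - i.+1 = n.+1 - i)%N by lia.
  by rewrite /G subKn ?(mulnC (catalan i)) // -ltnS.
have dbl : (2 * \sum_(i < n.+2) i.+1 * G i = n.+3 * \sum_(i < n.+2) G i)%N.
  rewrite mul2n -addnn {1}sym -big_split big_distrr /=; apply: eq_bigr => i _.
  by rewrite -mulnDl; congr (_ * _)%N; have := ltn_ord i; lia.
have red : (\sum_(i < n.+2) i.+1 * G i
          = catalan n.+1 + \sum_(i < n.+1) (4 * i + 2) * (catalan i * catalan (n - i)))%N.
  rewrite big_ord_recl /= {1}/G catalan0 !mul1n subn0; congr (_ + _)%N.
  apply: eq_bigr => i _; rewrite /bump leq0n add1n /G subSS.
  by rewrite mulnA catalan_rec mulnA.
pose H (i : nat) := (catalan i * catalan (n - i))%N.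
have symH : (\sum_(i < n.+1) i * H i = \sum_(i < n.+1) (n - i) * H i)%N.
  rewrite (reindex_inj rev_ord_inj) /=; apply: eq_bigr => i _.
  have -> : (n.+1 - i.+1 = n - i)%N by lia.
  by rewrite /H subKn ?(mulnC (catalan i)) // -ltnS.
have dblH : (2 * \sum_(i < n.+1) i * H i = n * \sum_(i < n.+1) H i)%N.
  rewrite mul2n -addnn {1}symH -big_split big_distrr /=; apply: eq_bigr => i _.
  by rewrite -mulnDl subnK // -ltnS.
have redH : (\sum_(i < n.+1) (4 * i + 2) * H i
           = 4 * (\sum_(i < n.+1) i * H i) + 2 * \sum_(i < n.+1) H i)%N.
  by rewrite !big_distrr -big_split /=; apply: eq_bigr => i _; rewrite mulnDl mulnA.
have IH' : (\sum_(i < n.+1) H i = catalan n.+1)%N by exact: IHn.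
rewrite -/H redH IH' in red; rewrite IH' in dblH.
have C2 := catalan_rec n.+1.
apply/eqP; rewrite -(eqn_pmul2l (ltn0Sn n.+2)) -/(G _); apply/eqP.
change (n.+3 * (\sum_(i < n.+2) G i) = n.+3 * catalan n.+2)%N.
by rewrite -dbl red C2; lia.
Qed.

(** * Decompositions of a finite set into maximal chains of a partial injection *)

Section ChainDecompositions.
Variables (T : finType) (r : rel T).
Implicit Types (P X : {set T}) (M : seq (seq T)).

Definition partial_injection P : Prop :=
  {in P & &, forall x y z, r x y -> r x z -> y = z} /\
  {in P & &, forall x y z, r x z -> r y z -> x = y}.

(* The lists of M are the maximal r-chains of P, up to empty lists. *)
Definition chains P M : Prop :=
  [/\ uniq (flatten M), flatten M =i P, all (sorted r) M
    & forall l1 x y l2, rcons l1 x \in M -> y :: l2 \in M -> ~~ r x y].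

Lemma uniq_flatten_inj M l l' x :
  uniq (flatten M) -> l \in M -> l' \in M -> x \in l -> x \in l' -> l = l'.
Proof.
elim: M => //= m M IHM; rewrite cat_uniq => /and3P[_ /hasPn disj uM].
have notin k : k \in M -> x \in k -> x \notin m.
  by move=> kM xk; apply: disj; apply/flattenP; exists k.
rewrite !inE => /orP[/eqP->|lM] /orP[/eqP->|l'M] // xl xl'.
- by rewrite (negPf (notin _ l'M xl')) in xl.
- by rewrite (negPf (notin _ lM xl)) in xl'.
- exact: IHM.
Qed.

Lemma uniq_flatten_mem M l : uniq (flatten M) -> l \in M -> uniq l.
Proof.
elim: M => //= m M IHM; rewrite cat_uniq inE => /and3P[um _ uM].
by case/orP=> [/eqP->|/IHM]; auto.
Qed.

Lemma uniq_flatten_filter M :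
  uniq (flatten M) -> uniq [seq l <- M | l != [::]].
Proof.
elim: M => //= m M IHM; rewrite cat_uniq => /and3P[_ /hasPn disj uM].
case: ifP => [mN0|_] /=; last exact: IHM.
rewrite IHM // andbT mem_filter mN0 /=; apply/negP=> mM.
case: m mN0 disj mM => // x m _ disj mM.
have /disj/= : x \in flatten M by apply/flattenP; exists (x :: m); rewrite ?mem_head.
by rewrite mem_head.
Qed.

Lemma uniq_cat_cons_inj (l1 a l2 b : seq T) x :
  uniq (l1 ++ x :: a) -> l1 ++ x :: a = l2 ++ x :: b -> a = b.
Proof.
have suf (l c : seq T) : uniq (l ++ x :: c) ->
    c = drop (index x (l ++ x :: c)).+1 (l ++ x :: c).
  rewrite cat_uniq /= => /and3P[_ /norP[xl _] _].
  by rewrite index_cat (negPf xl) /= eqxx addn0 -cat_rcons drop_size_cat ?size_rcons.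
by move=> u E; rewrite (suf l1 a u) {1 2}E -suf // -E.
Qed.

Lemma chains_mem P M l x : chains P M -> l \in M -> x \in l -> x \in P.
Proof. by case=> _ <- _ _ lM xl; apply/flattenP; exists l. Qed.

Lemma chains_sorted P M l : chains P M -> l \in M -> sorted r l.
Proof. by case=> _ _ /allP sM _ /sM. Qed.

Lemma sorted_adjacent (l1 l2 : seq T) x y :
  sorted r (l1 ++ x :: y :: l2) -> r x y.
Proof. by case: l1 => [|z l1] /=; [case/andP|rewrite cat_path /= => /and4P[]]. Qed.

(** If [x] ended its list, then maximality would forbid [y] to start one, so [y] has a predecessor
    in its list, and this is [x] by injectivity. *)
Lemma chains_next P M x y : partial_injection P -> chains P M ->
  x \in P -> y \in P -> r x y -> exists l1 l2, l1 ++ x :: y :: l2 \in M.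
Proof.
move=> [r_fun r_inj] cM xP yP rxy; have [_ fM _ nM] := cM.
have: x \in flatten M by rewrite fM.
case/flattenP=> l lM xl; case/splitPr: xl lM => l1 [|z l2] lM; last first.
  exists l1, l2; have := sorted_adjacent (chains_sorted cM lM) => rxz.
  have zP : z \in P.
    by apply: chains_mem cM lM _; rewrite mem_cat !inE eqxx !orbT.
  by rewrite (r_fun x y z).
have: y \in flatten M by rewrite fM.
case/flattenP=> l' l'M yl'; case/splitPr: yl' l'M => p q.
case/lastP: p => [|p z] l'M; first by rewrite cats1 in lM; have := nM _ _ _ _ lM l'M; rewrite rxy.
rewrite cat_rcons in l'M; have rzy := sorted_adjacent (chains_sorted cM l'M).
have zP : z \in P by apply: chains_mem cM l'M _; rewrite mem_cat !inE eqxx !orbT.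
by exists p, q; rewrite (r_inj x z y).
Qed.

Lemma chains_suffix P M M' (p l p' q : seq T) x : partial_injection P ->
  chains P M -> chains P M' -> p ++ x :: l \in M -> p' ++ x :: q \in M' -> l = q.
Proof.
move=> r_pi cM cM'; have [[uM _ _ _] [uM' _ _ _]] := (cM, cM').
elim: l p p' q x => [|z l IHl] p p' q x lM qM'.
  case: q qM' => // z q qM'.
  have xP : x \in P by apply: chains_mem cM lM _; rewrite mem_cat inE eqxx orbT.
  have zP : z \in P by apply: chains_mem cM' qM' _; rewrite mem_cat !inE eqxx !orbT.
  have rxz := sorted_adjacent (chains_sorted cM' qM').
  have [l1 [l2 l12M]] := chains_next r_pi cM xP zP rxz.
  have E : p ++ [:: x] = l1 ++ x :: z :: l2.
    by apply: (uniq_flatten_inj (x := x) uM); rewrite // mem_cat inE eqxx orbT.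
  by have := uniq_cat_cons_inj (uniq_flatten_mem uM lM) E.
have xP : x \in P by apply: chains_mem cM lM _; rewrite mem_cat inE eqxx orbT.
have zP : z \in P by apply: chains_mem cM lM _; rewrite mem_cat !inE eqxx !orbT.
have rxz := sorted_adjacent (chains_sorted cM lM).
have [l1 [l2 l12M]] := chains_next r_pi cM' xP zP rxz.
have E : p' ++ x :: q = l1 ++ x :: z :: l2.
  by apply: (uniq_flatten_inj (x := x) uM'); rewrite // mem_cat inE eqxx orbT.
have defq := uniq_cat_cons_inj (uniq_flatten_mem uM' qM') E.
rewrite defq; congr (_ :: _); apply: (IHl (rcons p x) (rcons p' x) l2 z).
  by rewrite cat_rcons.
by rewrite cat_rcons -defq.
Qed.

(** Beyond [chains_suffix], it remains to see that [x] starts its list in [M'] too: a predecessor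
    there would precede [x] in [M] as well, where [x] is a head. *)
Lemma chains_sub P M M' l : partial_injection P ->
  chains P M -> chains P M' -> l \in M -> l != [::] -> l \in M'.
Proof.
case: l => // x l r_pi cM cM' lM _; have [uM _ _ _] := cM.
have xP : x \in P by apply: chains_mem cM lM (mem_head _ _).
have [_ fM' _ _] := cM'; have: x \in flatten M' by rewrite fM'.
case/flattenP=> l' l'M xl'; case/splitPr: xl' l'M => p q.
case/lastP: p => [|p y] l'M; first by rewrite (chains_suffix (p := [::]) r_pi cM cM' lM l'M).
rewrite cat_rcons in l'M; have ryx := sorted_adjacent (chains_sorted cM' l'M).
have yP : y \in P by apply: chains_mem cM' l'M _; rewrite mem_cat !inE eqxx !orbT.
have [l1 [l2 l12M]] := chains_next r_pi cM yP xP ryx.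
have E : x :: l = l1 ++ y :: x :: l2.
  by apply: (uniq_flatten_inj (x := x) uM); rewrite ?mem_head // mem_cat !inE eqxx !orbT.
have := uniq_flatten_mem uM lM; rewrite E cat_uniq /=.
case: l1 E {l12M} => [[-> _]|z l1 [-> _]] /=.
  by rewrite mem_head /= andbF.
by rewrite mem_head orbT andbF.
Qed.

(** Maximal chains are unique up to empty lists, which [f 0 = 1] makes harmless. A product over
    chains can thus be computed from any decomposition at hand. *)
Lemma chains_prod P M M' (f : nat -> nat) : partial_injection P -> f 0%N = 1%N ->
  chains P M -> chains P M' ->
  (\prod_(l <- M) f (size l) = \prod_(l <- M') f (size l))%N.
Proof.
move=> r_pi f0 cM cM'.
have red N : (\prod_(l <- N) f (size l) =
              \prod_(l <- [seq l <- N | l != [::]]) f (size l))%N.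
  rewrite big_filter [LHS](bigID (fun l => l == [::])) /=.
  by rewrite big1 ?mul1n // => l /eqP->.
rewrite red [RHS]red; apply: perm_big; apply: uniq_perm.
- by case: cM => /uniq_flatten_filter.
- by case: cM' => /uniq_flatten_filter.
move=> l; rewrite !mem_filter; case: eqP => //= /eqP lN0.
by apply/idP/idP=> lM; [apply: chains_sub cM cM' lM lN0|apply: chains_sub cM' cM lM lN0].
Qed.

Lemma chains_perm P M M' : perm_eq M M' -> chains P M -> chains P M'.
Proof.
move=> eqM [uM fM sM nM]; have eqF := perm_flatten eqM; split.
- by rewrite -(perm_uniq eqF).
- by move=> x; rewrite -(perm_mem eqF) fM.
- by rewrite -(perm_all _ eqM).
- by move=> l1 x y l2; rewrite -!(perm_mem eqM); apply: nM.
Qed.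

(** Both parts remain maximal, because the end of [p] has only [x] as successor and the head of [q]
    only [x] as predecessor. Either part may be empty, so [chains] has to tolerate empty lists. *)
Lemma chains_split P M (p q : seq T) x : partial_injection P ->
  chains P ((p ++ x :: q) :: M) -> chains (P :\ x) (p :: q :: M).
Proof.
move=> r_pi cM; have [uM fM sM nM] := cM.
have /= eqF : perm_eq (flatten ((p ++ x :: q) :: M)) (x :: flatten (p :: q :: M)).
  by rewrite /= -catA -[(x :: q) ++ _]/([:: x] ++ _) perm_catCA.
have uM' : uniq (x :: flatten (p :: q :: M)) by rewrite -(perm_uniq eqF).
have {}fM y : y \in flatten (p :: q :: M) = (y \in P :\ x).
  rewrite !inE -fM (perm_mem eqF) inE /=; case: eqP => // ->.
  by case/andP: uM' => /negPf.
have xP : x \in P by apply: chains_mem cM (mem_head _ _) _; rewrite mem_cat inE eqxx orbT.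
have inP l y : l \in p :: q :: M -> y \in l -> (y != x) && (y \in P).
  by move=> lM yl; have := fM y; rewrite !inE => <-; apply/flattenP; exists l.
have sMl := chains_sorted cM (mem_head _ _).
split=> //; first by case/andP: uM'.
  move: sM => /= /andP[_ ->]; rewrite andbT.
  have := cat_sorted2 sMl => -[-> /=]; exact: path_sorted.
move=> l1 y z l2 l1M l2M; apply/negP=> ryz.
have /andP[yx yP] : (y != x) && (y \in P).
  by apply: inP l1M _; rewrite mem_rcons mem_head.
have /andP[zx zP] : (z != x) && (z \in P) by apply: inP l2M (mem_head _ _).
case: (r_pi) => r_fun r_inj; move: l1M l2M; rewrite !inE => l1M l2M.
have {}l1M : (rcons l1 y == q) || (rcons l1 y \in M).
  case/or3P: l1M => [/eqP Ep|->|->]; rewrite ?orbT //.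
  have := sMl; rewrite -Ep cat_rcons => /sorted_adjacent ryx.
  by rewrite (r_fun y z x) ?eqxx in zx.
have {}l2M : (z :: l2 == p) || (z :: l2 \in M).
  case/or3P: l2M => [->|/eqP Eq|->]; rewrite ?orbT //.
  have := sMl; rewrite -Eq => /sorted_adjacent rxz.
  by rewrite (r_inj y x z) ?eqxx in yx.
have [p1 Mp1]: exists p1, rcons p1 y \in (p ++ x :: q) :: M.
  case/orP: l1M => [/eqP<-|l1M]; last by exists l1; rewrite inE l1M orbT.
  by exists (p ++ x :: l1); rewrite -rcons_cons rcons_cat mem_head.
have [p2 Mp2]: exists p2, z :: p2 \in (p ++ x :: q) :: M.
  case/orP: l2M => [/eqP<-|l2M]; last by exists l2; rewrite inE l2M orbT.
  by exists (l2 ++ x :: q); rewrite mem_head.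
by have := nM _ _ _ _ Mp1 Mp2; rewrite ryz.
Qed.

Lemma partial_injectionS P P' :
  P' \subset P -> partial_injection P -> partial_injection P'.
Proof.
by move=> /subsetP sP [f i]; split=> x y z /sP xP /sP yP /sP zP; [apply: f|apply: i].
Qed.

(** Used to keep the outer chain of one run intact while blocks of other runs are removed. *)
Lemma chains_setD P X M l : partial_injection P -> X \subset P ->
  [disjoint X & l] -> chains P (l :: M) -> exists M', chains (P :\: X) (l :: M').
Proof.
move=> r_pi; have [n] := ubnP #|X|; elim: n X => // n IHn X leX sXP dXl cM.
have [->|[x xX]] := set_0Vmem X; first by exists M; rewrite setD0.
have [|||//|M' cM'] := IHn (X :\ x).
- by have := cardsD1 x X; rewrite xX; lia.
- exact: subset_trans (subsetDl _ _) sXP.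
- exact: disjointWl (subsetDl _ _) dXl.
have xl : x \notin l by rewrite (disjointFr dXl).
have: x \in flatten (l :: M').
  by case: cM' => _ -> _ _; rewrite !inE eqxx (subsetP sXP).
rewrite /= mem_cat (negPf xl) /= => /flattenP[l' l'M xl'].
have eqM := perm_to_rem l'M; case/splitPr: xl' eqM {l'M} => p q eqM.
have eqM1 : perm_eq (l :: M') ((p ++ x :: q) :: l :: rem (p ++ x :: q) M').
  apply: (@perm_trans _ (l :: (p ++ x :: q) :: rem (p ++ x :: q) M')).
    by rewrite perm_cons.
  set k := p ++ _; set N := rem _ _.
  by rewrite -[l :: k :: N]/([:: l] ++ [:: k] ++ N) perm_catCA.
have := chains_perm eqM1 cM'; move/chains_split.
case/(_ (partial_injectionS (subsetDl _ _) r_pi))=> uM fM sM nM.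
set N := rem _ _ in uM fM sM nM; exists (p :: q :: N).
apply: (@chains_perm _ (p :: q :: l :: N)).
  by rewrite perm_sym -[l :: p :: q :: N]/([:: l] ++ [:: p; q] ++ N) perm_catCA.
split=> // y; rewrite fM !inE; case: eqP => //= ->; by rewrite xX.
Qed.

End ChainDecompositions.

(** * The adjacent closure merges exactly the maximal chains of adjacent blocks *)

Section AdjacentClosure.
Variables (V : finType) (t : seq V).
Implicit Types (B C : {set V}) (P : {set {set V}}) (l : seq {set V}).

Definition block_family P : Prop :=
  [/\ trivIset P, set0 \notin P & cover P \subset [set x in t]].

Lemma block_family_inj P B C x :
  block_family P -> B \in P -> C \in P -> x \in B -> x \in C -> B = C.
Proof.
case=> trivP _ _ BP CP xB xC; apply/eqP; apply: contraLR xC => BC.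
by rewrite (disjointFr (trivIsetP trivP _ _ BP CP BC)).
Qed.

Lemma block_family_sub P P' : P' \subset P -> block_family P -> block_family P'.
Proof.
move=> sP [trivP P0 covP]; split.
- exact: trivIsetS trivP.
- by apply: contra P0; apply/subsetP.
- apply: subset_trans covP; apply/bigcupsP=> B BP'.
  by apply: bigcup_sup; apply: (subsetP sP).
Qed.

Lemma block_family_mem P B x : block_family P -> B \in P -> x \in B -> x \in t.
Proof.
case=> _ _ /subsetP covP BP xB; have := covP x; rewrite inE; apply.
by apply/bigcupP; exists B.
Qed.

Lemma followed_byP B C :
  reflect (exists x y, [/\ x \in B, y \in C,
             {in B, forall z, index z t <= index x t}%N,
             {in C, forall z, index y t <= index z t}%N
           & index y t = (index x t).+1])
          (followed_by t B C).
Proof.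
apply: (iffP 'exists_in_'exists_in_and3P).
  move=> [x xB [y yC [/forall_inP maxx /forall_inP miny /eqP E]]].
  by exists x, y.
move=> [x [y [xB yC maxx miny E]]].
exists x => //; exists y => //; split; [exact/forall_inP|exact/forall_inP|exact/eqP].
Qed.

Lemma followed_by_partial_injection P :
  block_family P -> partial_injection (followed_by t) P.
Proof.
move=> famP; split=> B C D BP CP DP.
  case/followed_byP=> x [y [xB yC maxx _ E]].
  case/followed_byP=> x' [y' [xB' yD maxx' _ E']].
  have eqx : index x t = index x' t.
    by apply/eqP; rewrite eqn_leq maxx // maxx'.
  apply: (block_family_inj famP CP DP yC).
  suff -> : y = y' by [].
  apply: (@index_inj _ y t); rewrite ?E ?E' ?eqx //.
  - exact: block_family_mem famP CP yC.
  - exact: block_family_mem famP DP yD.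
case/followed_byP=> x [y [xB yC _ miny E]].
case/followed_byP=> x' [y' [xB' yD _ miny' E']].
have eqy : index y t = index y' t.
  by apply/eqP; rewrite eqn_leq miny // miny'.
apply: (block_family_inj famP BP CP xB).
suff -> : x = x' by [].
apply: (@index_inj _ x t).
- exact: block_family_mem famP BP xB.
- exact: block_family_mem famP CP xB'.
- by apply/succn_inj; rewrite -E -E'.
Qed.

(** Transitivity needs the middle block to be nonempty. *)
Definition before B C : bool :=
  [&& B != set0, C != set0 & [forall x in B, forall y in C, index x t < index y t]]%N.

Lemma beforeP B C x y : before B C -> x \in B -> y \in C -> (index x t < index y t)%N.
Proof. by case/and3P=> _ _ /forall_inP lt xB yC; have /forall_inP->// := lt x xB. Qed.

Lemma before_trans : transitive before.
Proof.
move=> C B D BC CD; have [[B0 C0 _] [_ D0 _]] := (and3P BC, and3P CD).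
rewrite /before B0 D0; apply/forall_inP=> x xB; apply/forall_inP=> y yD.
have [z zC] := set0Pn _ C0.
exact: ltn_trans (beforeP BC xB zC) (beforeP CD zC yD).
Qed.

Lemma followed_by_before B C : followed_by t B C -> before B C.
Proof.
case/followed_byP=> x [y [xB yC maxx miny E]]; apply/and3P; split.
- by apply/set0Pn; exists x.
- by apply/set0Pn; exists y.
apply/forall_inP=> z zB; apply/forall_inP=> z' z'C.
by apply: leq_ltn_trans (maxx z zB) _; rewrite -E miny.
Qed.

Lemma chain_before l : sorted (followed_by t) l -> pairwise before l.
Proof.
rewrite -sorted_pairwise; last exact: before_trans.
exact/sub_sorted/followed_by_before.
Qed.

Definition union l : {set V} := \bigcup_(B <- l) B.

Lemma unionP l x : reflect (exists2 B, B \in l & x \in B) (x \in union l).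
Proof.
rewrite /union bigcup_seq; apply: (iffP bigcupP) => -[B]; by exists B.
Qed.

Lemma union_cat l k : union (l ++ k) = union l :|: union k.
Proof. by rewrite /union big_cat. Qed.

(** The blocks of a chain come one after the other, so the union of a chain attains its maximum in
    the last block and its minimum in the first. *)
Lemma followed_by_union l k B C : set0 \notin rcons l B -> set0 \notin C :: k ->
  sorted (followed_by t) (rcons l B) -> sorted (followed_by t) (C :: k) ->
  followed_by t (union (rcons l B)) (union (C :: k)) = followed_by t B C.
Proof.
move=> l0 k0 /chain_before; rewrite pairwise_rcons => /andP[/allP lB _].
move=> /chain_before /= /andP[/allP kC _].
have B0 : B != set0.
  by apply: contraNneq l0 => ->; rewrite mem_rcons mem_head.
have C0 : C != set0 by apply: contraNneq k0 => ->; rewrite mem_head.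
have subB x : x \in B -> x \in union (rcons l B).
  by move=> xB; apply/unionP; exists B; rewrite // mem_rcons mem_head.
have subC x : x \in C -> x \in union (C :: k).
  by move=> xC; apply/unionP; exists C; rewrite // mem_head.
apply/followed_byP/followed_byP=> -[x [y [xB yC maxx miny E]]]; exists x, y.
  split=> //; try by [move=> z /subB/maxx|move=> z /subC/miny].
    have [b bB] := set0Pn _ B0; case/unionP: xB => D; rewrite mem_rcons inE.
    case/orP=> [/eqP->//|/lB DB] xD; have := maxx b (subB b bB).
    by rewrite leqNgt (beforeP DB).
  have [c cC] := set0Pn _ C0; case/unionP: yC => D; rewrite inE.
  case/orP=> [/eqP->//|/kC DC] xD; have := miny c (subC c cC).
  by rewrite leqNgt (beforeP DC).
split=> //; [exact: subB|exact: subC| |] => z /unionP[D].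
  rewrite mem_rcons inE => /orP[/eqP->/maxx//|/lB DB zD].
  exact/ltnW/(beforeP DB).
rewrite inE => /orP[/eqP->/miny//|/kC DC zD].
exact/ltnW/(beforeP DC).
Qed.

(* A state of the merging process: the current blocks are the unions of the  *)
(* lists of N, each of which consists of consecutive blocks of a chain.      *)
Definition merge_state P (N : seq (seq {set V})) P' : Prop :=
  [/\ uniq (flatten N), flatten N =i P, all (sorted (followed_by t)) N,
      [::] \notin N & P' = [set B in map union N]].

Lemma union_inj P N P' l k : block_family P -> merge_state P N P' ->
  l \in N -> k \in N -> union l = union k -> l = k.
Proof.
move=> famP [uN fN _ N0 _] lN kN eqU.
have inP m B : m \in N -> B \in m -> B \in P.
  by move=> mN Bm; rewrite -fN; apply/flattenP; exists m.
case: l lN eqU => [|B l] lN eqU; first by rewrite lN in N0.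
have BP : B \in P by apply: inP lN (mem_head _ _).
have /set0Pn[b bB] : B != set0 by case: famP => _ P0 _; apply: contraNneq P0 => <-.
have: b \in union k by rewrite -eqU; apply/unionP; exists B; rewrite ?mem_head.
case/unionP=> C Ck bC.
apply: (uniq_flatten_inj (x := B) uN lN kN (mem_head _ _)).
by rewrite (block_family_inj famP BP (inP _ _ kN Ck) bB bC).
Qed.

(** If no merge is possible, [followed_by_union] shows that the lists are maximal chains; otherwise
    the two lists concerned are concatenated. *)
Lemma merge_step P N P' : block_family P -> merge_state P N P' ->
  (merge_once t P' = P' /\ chains (followed_by t) P N) \/
  (exists2 N', merge_state P N' (merge_once t P') & (size N' < size N)%N).
Proof.
move=> famP stN; have [uN fN sN N0 defP'] := stN.
have set0N l : l \in N -> set0 \notin l.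
  move=> lN; case: famP => _ P0 _; apply: contra P0 => l0.
  by rewrite -fN; apply/flattenP; exists l.
rewrite /merge_once; case: pickP => [[C D] /= /and3P[CP' DP' fCD]|no]; last first.
  left; split=> //; split=> // l B C k lN kN.
  rewrite -(@followed_by_union l k) ?set0N ?(allP sN) //.
  have /= := no (union (rcons l B), union (C :: k)).
  by rewrite defP' !inE !map_f //= => ->.
right; move: CP' DP'; rewrite defP' !inE => /mapP[l lN defC] /mapP[k kN defD].
(* A block never follows itself, as its minimum would then exceed its maximum. *)
have lk : k != l.
  apply: contraTneq fCD => kl; apply/negP; rewrite defC defD kl => /followed_byP.
  by case=> x [y [_ yl /(_ y yl)]]; lia.
have uN' : uniq N.
  have := uniq_flatten_filter uN; rewrite (_ : [seq _ <- N | _] = N) //.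
  by apply/all_filterP/allP=> m mN; apply: contraNneq N0 => <-.
pose N' := rem k (rem l N).
have eqN : perm_eq N (l :: k :: N').
  apply: perm_trans (perm_to_rem lN) _; rewrite perm_cons; apply: perm_to_rem.
  by rewrite mem_rem_uniq // inE lk.
have N'E m : (m \in N') = [&& m != k, m != l & m \in N].
  by rewrite !mem_rem_uniq ?rem_uniq // !inE mem_rem_uniq // inE.
exists ((l ++ k) :: N'); last by have := perm_size eqN; rewrite /=; lia.
have eqF := perm_flatten eqN; split.
- by rewrite /= -catA -(perm_uniq eqF).
- by move=> B; rewrite -fN (perm_mem eqF) /= catA.
- have := sN; rewrite (perm_all _ eqN) /= => /and3P[sl sk ->]; rewrite andbT.
  have l0 : l != [::] by apply: contraNneq N0 => <-.
  have k0 : k != [::] by apply: contraNneq N0 => <-.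
  have nl := set0N _ lN; have nk := set0N _ kN.
  case/lastP: l l0 sl nl defC {lN lk N' eqN N'E eqF} => // l B _ sl nl defC.
  case: k k0 sk nk defD {kN} => // E k _ sk nk defD.
  move: fCD; rewrite defC defD followed_by_union // => fBE.
  by rewrite cat_rcons; case: l sl {nl defC} => [|A l] /=;
    rewrite ?fBE // rcons_path cat_path /= => /andP[-> ->]; rewrite fBE.
- rewrite inE negb_or N'E (negPf N0) !andbF andbT.
  by apply: contraNneq N0 => /esym/(congr1 size); case: (l) lN.
apply/setP=> E; rewrite in_setU1 !in_setD1 !in_set defC defD -union_cat; apply/idP/mapP.
  case/orP=> [/eqP->|/and3P[ED EC]]; first by exists (l ++ k); rewrite ?mem_head.
  case/mapP=> m mN defE; exists m => //.
  rewrite inE N'E mN andbT; apply/orP; right.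
  by apply/andP; split; [apply: contraNneq ED|apply: contraNneq EC] => <-; rewrite defE.
move=> [m]; rewrite inE N'E => /orP[/eqP->->|/and3P[mk ml mN] ->]; rewrite ?eqxx //.
apply/orP; right; rewrite map_f // andbT.
apply/andP; split; [apply: contraNneq mk|apply: contraNneq ml] => eqU.
  by apply/eqP; apply: (union_inj famP stN).
by apply/eqP; apply: (union_inj famP stN).
Qed.

Definition merge_closure P : {set {set V}} := iter #|P| (merge_once t) P.

(** A round that changes anything lowers the number of lists, which is [#|P|] at first, so the
    process is stable after [#|P|] rounds. *)
Lemma merge_closure_state P : block_family P ->
  exists2 N, merge_state P N (merge_closure P) & chains (followed_by t) P N.
Proof.
move=> famP.
pose stable N P' := merge_once t P' = P' /\ chains (followed_by t) P N.
have main n : exists2 N, merge_state P N (iter n (merge_once t) P) &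
    stable N (iter n (merge_once t) P) \/ (size N + n <= #|P|)%N.
  elim: n => [|n [N stN stop]].
    exists [seq [:: B] | B <- enum P]; last by right; rewrite size_map -cardE addn0.
    have F : flatten [seq [:: B] | B <- enum P] = enum P.
      by elim: (enum P) => //= B l ->.
    split; rewrite ?F ?enum_uniq //.
    - by move=> B; rewrite mem_enum.
    - by apply/allP=> _ /mapP[B _ ->].
    - by apply/negP=> /mapP[].
    apply/setP=> B; rewrite inE; apply/idP/mapP=> [BP|[_ /mapP[C CP ->] ->]].
      by exists [:: B]; rewrite ?map_f ?mem_enum // /union big_seq1.
    by rewrite /union big_seq1 -mem_enum.
  case: stop => [[E cN]|leN]; first by exists N; rewrite /stable /= ?E //; left.
  have [[E cN]|[N' stN' ltN]] := merge_step famP stN.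
    by exists N; rewrite /stable /= ?E //; left.
  by exists N'; [|right; lia].
have [N stN [[_ cN]|leN]] := main #|P|; exists N => //.
(* The size bound leaves no list, so [P] is empty and the empty decomposition is maximal. *)
have N0 : N = [::] by case: (N) leN => //= m l; lia.
by rewrite N0 in stN *; case: stN => _ fN _ _ _; split.
Qed.

(** Blocks are disjoint and nonempty, so the members of [P] inside the union of a list of the final
    state are the members of that list; [chains_prod] then passes from this decomposition to [M]. *)
Lemma closure_catalan_chains P M : block_family P ->
  chains (followed_by t) P M ->
  (\prod_(B in merge_closure P) catalan #|[set D in P | D \subset B]| =
   \prod_(l <- M) catalan (size l))%N.
Proof.
move=> famP cM; have [N stN cN] := merge_closure_state famP.
rewrite (chains_prod (followed_by_partial_injection famP) catalan0 cM cN).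
have [uN fN _ N0 ->] := stN.
have uN' : uniq N.
  have := uniq_flatten_filter uN; rewrite (_ : [seq _ <- N | _] = N) //.
  by apply/all_filterP/allP=> m mN; apply: contraNneq N0 => <-.
under eq_bigl do rewrite inE.
rewrite -big_uniq; last first.
  by rewrite map_inj_in_uniq // => l k lN kN; apply: union_inj famP stN lN kN.
rewrite big_map /= big_seq [RHS]big_seq; apply: eq_bigr => l lN; congr catalan.
rewrite -(card_uniqP (uniq_flatten_mem uN lN)); apply: eq_card => D; rewrite inE.
have inP m B : m \in N -> B \in m -> B \in P.
  by move=> mN Bm; rewrite -fN; apply/flattenP; exists m.
apply/andP/idP=> [[DP sD]|Dl].
  have /set0Pn[x xD] : D != set0 by case: famP => _ P0 _; apply: contraNneq P0 => <-.
  have /unionP[B Bl xB] := subsetP sD x xD.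
  by rewrite (block_family_inj famP DP (inP _ _ lN Bl) xD xB).
split; first exact: inP lN Dl.
by apply/subsetP=> x xD; apply/unionP; exists D.
Qed.

End AdjacentClosure.

(** * Noncrossing families on runs, and the blocks that one recursion step can remove *)

Section RemovalSum.
Variables (V : finType) (t : seq V).
Implicit Types (x y z : V) (B C S U : {set V}) (P Q X : {set {set V}}).
Local Notation idx x := (index x t).

(* For x, y \in t: x and y are in the same run of consecutive elements of U. *)
Definition linked U x y : bool :=
  [forall z, (minn (idx x) (idx y) <= idx z <= maxn (idx x) (idx y))%N ==> (z \in U)].

Lemma linkedP U x y : reflect
  (forall z, (minn (idx x) (idx y) <= idx z <= maxn (idx x) (idx y))%N -> z \in U)
  (linked U x y).
Proof. exact: 'forall_implyP. Qed.

Lemma linked_sym U x y : linked U x y = linked U y x.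
Proof. by rewrite /linked minnC maxnC. Qed.

Lemma linked_trans U : transitive (linked U).
Proof.
move=> y x z /linkedP xy /linkedP yz; apply/linkedP=> w w_xz.
have [le|lt] := boolP (minn (idx x) (idx y) <= idx w <= maxn (idx x) (idx y))%N.
  exact: xy.
by apply: yz; lia.
Qed.

Lemma linkedr U x y : linked U x y -> y \in U.
Proof. by move/linkedP; apply; lia. Qed.

Lemma linked_in U x y z : linked U x y ->
  (idx x <= idx z)%N -> (idx z <= idx y)%N -> z \in U.
Proof. by move=> /linkedP xy xz zy; apply: xy; lia. Qed.

Lemma linkedWl U x y z : linked U x y ->
  (idx x <= idx z)%N -> (idx z <= idx y)%N -> linked U x z.
Proof. by move=> /linkedP xy xz zy; apply/linkedP=> w wxz; apply: xy; lia. Qed.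

Lemma linkedI U x y : (idx x <= idx y)%N ->
  (forall z, (idx x <= idx z)%N -> (idx z <= idx y)%N -> z \in U) -> linked U x y.
Proof. by move=> xy zU; apply/linkedP=> z z_xy; apply: zU; lia. Qed.

(** Thus [B] lies in one component of the forest that [t] induces on [U]. *)
Definition arcwise U B : bool := [forall x in B, forall y in B, linked U x y].

Lemma arcwiseP U B : reflect {in B &, forall x y, linked U x y} (arcwise U B).
Proof.
apply: (iffP forall_inP) => [l x y xB yB|l x xB]; first by have /forall_inP/(_ y yB) := l x xB.
by apply/forall_inP=> y yB; apply: l.
Qed.

(* A noncrossing partition of each component of the forest that t induces    *)
(* on U.                                                                     *)
Definition run_NC U : {set {set {set V}}} :=
  [set P | [&& partition P U, noncrossing t P & [forall B in P, arcwise U B]]].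

Lemma noncrossingP P : reflect
  (forall B C a b c d, B \in P -> C \in P -> B != C -> a \in B -> b \in C ->
     c \in B -> d \in C -> (idx a < idx b)%N -> (idx b < idx c)%N ->
     (idx c < idx d)%N -> False)
  (noncrossing t P).
Proof.
apply: (iffP idP) => [nc B C a b c d BP CP BC aB bC cB dC ab bc cd|nc].
  move: nc => /forall_inP/(_ B BP)/forall_inP/(_ C CP)/implyP/(_ BC).
  move=> /forall_inP/(_ a aB)/forall_inP/(_ c cB).
  by move=> /forall_inP/(_ b bC)/forall_inP/(_ d dC); rewrite ab bc cd.
apply/forall_inP=> B BP; apply/forall_inP=> C CP; apply/implyP=> BC.
apply/forall_inP=> a aB; apply/forall_inP=> c cB.
apply/forall_inP=> b bC; apply/forall_inP=> d dC.
by apply/negP=> /and3P[ab bc cd]; apply: (nc B C a b c d).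
Qed.

Lemma noncrossingS P P' : P' \subset P -> noncrossing t P -> noncrossing t P'.
Proof.
move=> /subsetP sP /noncrossingP nc; apply/noncrossingP=> B C a b c d /sP BP /sP CP.
exact: nc.
Qed.

Lemma run_NCP U P : reflect
  [/\ partition P U, noncrossing t P & {in P, forall B, arcwise U B}]
  (P \in run_NC U).
Proof. by rewrite inE; apply: (iffP and3P) => -[? ? /forall_inP]. Qed.

Lemma run_NC_family U P : U \subset [set x in t] -> P \in run_NC U -> block_family t P.
Proof. by move=> sU /run_NCP[/and3P[/eqP covP ? ?] _ _]; split; rewrite ?covP. Qed.

(** The coefficient of [P] in the antipode of a forest. *)
Definition weight P : int :=
  (-1) ^+ #|P| * (\prod_(B in merge_closure t P) catalan #|[set D in P | D \subset B]|)%N%:Z.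

Lemma weight_chains P M : block_family t P -> chains (followed_by t) P M ->
  weight P = (-1) ^+ #|P| * (\prod_(l <- M) catalan (size l))%N%:Z.
Proof. by move=> famP cM; rewrite /weight (closure_catalan_chains famP cM). Qed.

(** For [S] inside [U], these are the nonempty intersections of [S] with the components of the
    forest on [U]. *)
Definition pieces U S : {set {set V}} := equivalence_partition (linked U) S.

(* The blocks of Q that one term S of the antipode recursion can remove.     *)
Definition removable U Q X : bool :=
  [&& X \subset Q, Q :\: X \in run_NC (U :\: cover X) & pieces U (cover X) == X].

Definition under C B : bool :=
  [exists x in B, exists y in B, exists z in C, (idx x < idx z < idx y)%N].

Lemma underP C B : reflect
  (exists x y z, [/\ x \in B, y \in B, z \in C, idx x < idx z & idx z < idx y]%N)
  (under C B).
Proof.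
apply: (iffP 'exists_in_'exists_in_'exists_in_andP).
  by move=> [x xB [y yB [z zC [xz zy]]]]; exists x, y, z.
by move=> [x [y [z [xB yB zC xz zy]]]]; exists x => //; exists y => //; exists z.
Qed.


(** The two conditions say that each block of [X] is a full class of [linked U] on [cover X]. *)
Lemma pieces_cover U X : trivIset X -> set0 \notin X ->
  reflect ({in X, forall B, arcwise U B} /\
           {in X &, forall B C, {in B & C, forall x y, linked U x y -> B = C}})
          (pieces U (cover X) == X).
Proof.
move=> trivX X0; apply: (iffP eqP) => [defX|[arcX sepX]].
  have blockX B x : B \in X -> x \in B -> B = [set y in cover X | linked U x y].
    rewrite -{1}defX => /imsetP[z zX defB] xB; rewrite defB.
    have : x \in B by []; rewrite defB inE => /andP[xX zx].
    apply/setP=> y; rewrite !inE; case: (y \in _) => //=.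
    apply/idP/idP=> [zy|]; last exact: linked_trans.
    by apply: linked_trans zy; rewrite linked_sym.
  split=> [B BX|B C BX CX x y xB yC xy].
    by apply/arcwiseP=> x y xB; rewrite {1}(blockX B x BX xB) inE => /andP[].
  have yB : y \in B.
    by rewrite (blockX B x BX xB) inE xy andbT; apply/bigcupP; exists C.
  apply/eqP; apply: contraLR yC => BC.
  by rewrite (disjointFr (trivIsetP trivX _ _ BX CX BC)).
have blockX B x : B \in X -> x \in B -> B = [set y in cover X | linked U x y].
  move=> BX xB; apply/setP=> y; rewrite inE; apply/idP/andP=> [yB|[]].
    by split; [apply/bigcupP; exists B|apply: (arcwiseP _ _ (arcX B BX))].
  by case/bigcupP=> C CX yC /(sepX B C BX CX x y xB yC)->.
apply/setP=> B; apply/imsetP/idP=> [[x /bigcupP[C CX xC] ->]|BX].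
  by rewrite -(blockX C x).
have /set0Pn[x xB] : B != set0 by apply: contraNneq X0 => <-.
by exists x; [apply/bigcupP; exists B|apply: blockX].
Qed.

(** Suppose that [C] in [X] lies under [B]. If [B] is in [X] too, the two share a run; if not, [B]
    straddles a gap of [U :\: cover X]. Conversely, a remaining block with no removed block under it
    still lies in a single run. *)
Lemma removableP U Q X : U \subset [set x in t] -> Q \in run_NC U ->
  reflect [/\ X \subset Q, {in X & Q, forall C B, C != B -> ~~ under C B}
            & {in X &, forall B C, {in B & C, forall x y, linked U x y -> B = C}}]
          (removable U Q X).
Proof.
move=> sUt QNC; have famQ := run_NC_family sUt QNC.
have [partQ ncQ arcQ] := run_NCP _ _ QNC; have [/eqP covQ trivQ Q0] := and3P partQ.
apply: (iffP and3P) => [[sXQ QX pX]|[sXQ noX sepX]].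
  have /pieces_cover := pX.
  case=> [||_ sepX]; first exact: trivIsetS trivQ.
    by apply: contra Q0; apply: (subsetP sXQ).
  split=> // C B CX BQ CB; apply/underP=> -[x [y [z [xB yB zC xz zy]]]].
  have [BX|BX] := boolP (B \in X).
    have xy := arcwiseP _ _ (arcQ B BQ) x y xB yB.
    have xz' : linked U x z by apply: linkedWl xy _ _; apply: ltnW.
    by rewrite (sepX B C BX CX x z xB zC xz') eqxx in CB.
  have BQX : B \in Q :\: X by rewrite inE BX.
  have [_ _ /(_ B BQX)/arcwiseP/(_ x y xB yB)/linked_in] := run_NCP _ _ QX.
  move=> /(_ z (ltnW xz) (ltnW zy)); rewrite inE => /andP[/negP[]].
  by apply/bigcupP; exists C.
split=> //; last first.
  apply/pieces_cover; first exact: trivIsetS trivQ.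
    by apply: contra Q0; apply: (subsetP sXQ).
  by split=> // B /(subsetP sXQ)/arcQ.
apply/run_NCP; split.
- apply/and3P; split.
  + apply/eqP/setP=> x; rewrite inE -covQ; apply/bigcupP/andP=> [[B]|[xX]].
      rewrite inE => /andP[BX BQ] xB; split; last by apply/bigcupP; exists B.
      apply/bigcupP=> -[C CX xC]; move: BX.
      by rewrite (block_family_inj famQ BQ (subsetP sXQ C CX) xB xC) CX.
    case/bigcupP=> B BQ xB; exists B; rewrite // inE BQ andbT.
    by apply: contra xX => BX; apply/bigcupP; exists B.
  + exact: trivIsetS (subsetDl _ _) trivQ.
  + by rewrite inE negb_and Q0 orbT.
- exact: noncrossingS (subsetDl _ _) ncQ.
move=> B; rewrite inE => /andP[BX BQ]; apply/arcwiseP.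
suff le x y : x \in B -> y \in B -> (idx x <= idx y)%N -> linked (U :\: cover X) x y.
  move=> x y xB yB; have [|/ltnW] := leqP (idx x) (idx y); first exact: le.
  by rewrite linked_sym; apply: le.
move=> xB yB xy; apply: linkedI => // z xz zy.
have zU : z \in U by apply: linked_in (arcwiseP _ _ (arcQ B BQ) x y xB yB) xz zy.
rewrite inE zU andbT; apply/bigcupP=> -[C CX zC].
have CQ := subsetP sXQ C CX.
have CB : C != B by apply: contraNneq BX => <-.
have neq v : v \in B -> idx z != idx v.
  move=> vB; apply/eqP => /index_inj zv; move: CB.
  rewrite (block_family_inj famQ CQ BQ zC) ?eqxx //.
  by rewrite zv //; [apply: block_family_mem famQ CQ zC|apply: block_family_mem famQ BQ vB].
have /negP[] := noX C B CX BQ CB; apply/underP; exists x, y, z; split=> //.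
  by rewrite ltn_neqAle eq_sym neq.
by rewrite ltn_neqAle neq.
Qed.

Lemma linked_refl U x : U \subset [set x in t] -> x \in U -> linked U x x.
Proof.
move=> sUt xU; apply: linkedI => // z xz zx.
have xt : x \in t by have := subsetP sUt x xU; rewrite inE.
suff -> : z = x by [].
by apply/esym/(@index_inj _ x t x z) => //; [rewrite -index_mem (leq_ltn_trans zx) ?index_mem|lia].
Qed.

Lemma linkedS U U' x y : U \subset U' -> linked U x y -> linked U' x y.
Proof. by move=> /subsetP sU /linkedP xy; apply/linkedP=> z /xy/sU. Qed.

Lemma pieces_partition U S : U \subset [set x in t] -> S \subset U ->
  partition (pieces U S) S.
Proof.
move=> sUt /subsetP sSU; apply: equivalence_partitionP => x y z xS yS zS; split.
  by apply: linked_refl => //; apply: sSU.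
move=> xy; apply/idP/idP; last exact: linked_trans.
by apply: linked_trans; rewrite linked_sym.
Qed.

(** It confines the rearranged recursion to the [Q] that [removal_sum] covers. No remaining block
    crosses a removed one, because the arcs of the former avoid [cover X]; two removed blocks lie in
    different runs. *)
Lemma removable_run_NC U Q X : U \subset [set x in t] ->
  removable U Q X -> Q \in run_NC U.
Proof.
move=> sUt /and3P[sXQ QX /eqP pX].
have [/and3P[/eqP covP trivP P0] /noncrossingP ncP arcP] := run_NCP _ _ QX.
have sRU : cover X \subset U.
  apply/subsetP=> x /bigcupP[B]; rewrite -{1}pX => /imsetP[z _ ->].
  by rewrite inE => /andP[_ /linkedr].
have := pieces_partition sUt sRU; rewrite pX => /and3P[_ trivX X0].
have [|arcX sepX] := pieces_cover U trivX X0 _; first exact/eqP.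
have inR B x : B \in X -> x \in B -> x \in cover X.
  by move=> BX xB; apply/bigcupP; exists B.
have notR B x y z : B \in Q -> B \notin X -> x \in B -> y \in B ->
    (idx x <= idx z)%N -> (idx z <= idx y)%N -> z \notin cover X.
  move=> BQ BX xB yB xz zy; have /arcP/arcwiseP : B \in Q :\: X by rewrite inE BX.
  move=> /(_ x y xB yB)/linked_in/(_ xz zy); by rewrite inE => /andP[].
have QE : Q = X :|: (Q :\: X) by rewrite setDE setUIr setUCr setIT; apply/esym/setUidPr.
apply/run_NCP; split.
- apply/and3P; split.
  + by rewrite QE /cover bigcup_setU -/(cover _) -/(cover (Q :\: X)) covP setDE
      setUIr setUCr setIT; apply/eqP/setUidPr.
  + apply/trivIsetP=> B C BQ CQ BC.
    have [BX|BX] := boolP (B \in X); have [CX|CX] := boolP (C \in X).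
    * exact: (trivIsetP trivX).
    * rewrite -setI_eq0; apply/eqP/setP=> x; rewrite !inE; apply/andP=> -[xB xC].
      by have /negP[] := notR C x x x CQ CX xC xC (leqnn _) (leqnn _); apply: inR xB.
    * rewrite -setI_eq0; apply/eqP/setP=> x; rewrite !inE; apply/andP=> -[xB xC].
      by have /negP[] := notR B x x x BQ BX xB xB (leqnn _) (leqnn _); apply: inR xC.
    * by apply: (trivIsetP trivP); rewrite ?inE ?BX ?CX.
  + by rewrite QE inE negb_or X0.
- apply/noncrossingP=> B C a b c d BQ CQ BC aB bC cB dC ab bc cd.
  have [BX|BX] := boolP (B \in X); have [CX|CX] := boolP (C \in X).
  + have := arcwiseP _ _ (arcX B BX) a c aB cB.
    move=> /linkedWl/(_ (ltnW ab) (ltnW bc))/(sepX B C BX CX a b aB bC) E.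
    by rewrite E eqxx in BC.
  + by have /negP[] := notR C b d c CQ CX bC dC (ltnW bc) (ltnW cd); apply: inR cB.
  + by have /negP[] := notR B a c b BQ BX aB cB (ltnW ab) (ltnW bc); apply: inR bC.
  + by apply: (ncP B C a b c d); rewrite ?inE ?BX ?CX.
move=> B BQ; have [/arcX//|BX] := boolP (B \in X).
apply/arcwiseP=> x y xB yB; apply: (linkedS (subsetDl U (cover X))).
by apply: (arcwiseP _ _ (arcP B _)); rewrite ?inE ?BX.
Qed.

(* A chain of blocks starting at the first element of a run consists exactly *)
(* of the blocks of the run that are under no other block.                   *)
Lemma outer_chain U Q : uniq t -> U \subset [set x in t] -> U != set0 -> Q \in run_NC U ->
  exists d l M, [/\ chains (followed_by t) Q (l :: M), l != [::],
    {in l, forall C, {in C, forall x, linked U d x}},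
    {in l & Q, forall C B, C != B -> ~~ under C B}
  & {in Q, forall C, {in C, forall x, linked U d x ->
      {in Q, forall B, C != B -> ~~ under C B} -> C \in l}}].
Proof.
move=> uniq_t sUt U0 QNC; have famQ := run_NC_family sUt QNC.
have [/and3P[/eqP covQ trivQ Q0] /noncrossingP ncQ arcQ] := run_NCP _ _ QNC.
have r_pi := followed_by_partial_injection famQ.
have idx_neq B C x y : B \in Q -> C \in Q -> B != C -> x \in B -> y \in C -> idx x <> idx y.
  move=> BQ CQ BC xB yC /index_inj xy; move: BC.
  rewrite (block_family_inj famQ BQ CQ xB) ?eqxx // xy //.
    exact: block_family_mem famQ BQ xB.
  exact: block_family_mem famQ CQ yC.
have idx_lt B C x y : B \in Q -> C \in Q -> B != C -> x \in B -> y \in C ->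
    (idx x <= idx y)%N -> (idx x < idx y)%N.
  by move=> BQ CQ BC xB yC; rewrite ltn_neqAle => ->; rewrite andbT; apply/eqP/(idx_neq B C).
have [N _ cN] := merge_closure_state famQ; have [uN fN sN nN] := cN.
have [d0 d0U] := set0Pn _ U0.
case: (arg_minnP (fun x => idx x) d0U) => d dU mind.
have: d \in cover Q by rewrite covQ.
case/bigcupP=> B1 B1Q dB1; have: B1 \in flatten N by rewrite fN.
case/flattenP=> l0 l0N B1l0; case/splitPr: B1l0 l0N => p l'.
(* [B1] heads its list, as a predecessor would contain an element of [U] before [d]. *)
case/lastP: p => [|p C] l0N; last first.
  have CQ : C \in Q by apply: chains_mem cN l0N _; rewrite cat_rcons mem_cat !inE eqxx !orbT.
  move: (chains_sorted cN l0N); rewrite cat_rcons => /sorted_adjacent/followed_byP.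
  case=> x [y [xC yB1 _ miny E]]; have := miny d dB1; rewrite E ltnNge mind //.
  by rewrite -covQ; apply/bigcupP; exists C.
pose l := B1 :: l'; have {}l0N : l \in N := l0N.
have eqN := perm_to_rem l0N; set M := rem _ _ in eqN.
have lQ : {subset l <= Q} by move=> B Bl; apply: chains_mem cN l0N Bl.
have sl : sorted (followed_by t) l := chains_sorted cN l0N.
(* Consecutive blocks of a chain leave no gap, so every position spanned by the chain is spanned by
   one of its blocks. *)
have hull k B b c z : path (followed_by t) B k -> b \in B -> c \in last B k ->
    (idx b <= idx z)%N -> (idx z <= idx c)%N ->
    exists C c1 c2, [/\ C \in B :: k, c1 \in C, c2 \in C, idx c1 <= idx z & idx z <= idx c2]%N.
  elim: k B b => [|C k IHk] B b /= => [_ bB cB bz zc|/andP[BC kP] bB ck bz zc].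
    by exists B, b, c; rewrite mem_head.
  have /followed_byP[x [y [xB yC maxx miny E]]] := BC.
  have [zx|xz] := leqP (idx z) (idx x); first by exists B, b, x; rewrite mem_head.
  have [|D [c1 [c2 [Dk ? ? ? ?]]]] := IHk C y kP yC ck _ zc; first by rewrite E.
  by exists D, c1, c2; rewrite inE Dk orbT.
have LQ : last B1 l' \in Q by apply/lQ/mem_last.
have /set0Pn[m0 m0L] : last B1 l' != set0 by apply: contraNneq Q0 => <-.
case: (arg_maxnP (fun x => idx x) m0L) => m mL maxm.
have pw := chain_before sl.
have le_m C x : C \in l -> x \in C -> (idx x <= idx m)%N.
  have: l = rcons (belast B1 l') (last B1 l') by rewrite -lastI.
  move=> defl; move: pw; rewrite defl pairwise_rcons => /andP[/allP CL _].
  rewrite mem_rcons inE => /orP[/eqP->|/CL]; first exact: maxm.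
  by move=> CLb xC; apply/ltnW/(beforeP CLb).
(* The chain reaches the end of the run. Otherwise the element [z] after its maximum [m] would, by
   noncrossing, be the minimum of its block, and this block would prolong a maximal chain. *)
have cover_run u : linked U d u -> exists C c1 c2,
    [/\ C \in l, c1 \in C, c2 \in C, idx c1 <= idx u & idx u <= idx c2]%N.
  move=> du; have [um|mu] := leqP (idx u) (idx m).
    by apply: (hull l' B1 d m) => //; apply/mind/(linkedr du).
  have ut : u \in t by have := subsetP sUt u (linkedr du); rewrite inE.
  have lt_mt : ((idx m).+1 < size t)%N by apply: leq_ltn_trans mu _; rewrite index_mem.
  exfalso; pose z := nth d t (idx m).+1.
  have idz : idx z = (idx m).+1 by rewrite index_uniq.
  have dm : (idx d <= idx m)%N by apply: le_m dB1; rewrite mem_head.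
  have zU : z \in U by apply: linked_in du _ _; rewrite idz // ltnW.
  have: z \in cover Q by rewrite covQ.
  case/bigcupP=> C CQ zC.
  have minz c : c \in C -> (idx z <= idx c)%N.
    move=> cC; rewrite leqNgt; apply/negP; rewrite idz ltnS => cm.
    have cU : c \in U by rewrite -covQ; apply/bigcupP; exists C.
    have [D [c1 [c2 [Dl c1D c2D cc1 cc2]]]] := hull l' B1 d m c sl dB1 mL (mind c cU) cm.
    have DC : D != C.
      by apply: contraTneq Dl => ->; apply/negP=> /le_m/(_ zC); rewrite idz ltnn.
    apply: (ncQ D C c1 c c2 z (lQ D Dl) CQ DC) => //.
    - exact: (idx_lt D C _ _ (lQ D Dl)).
    - by apply: (idx_lt C D _ _ CQ (lQ D Dl)); rewrite // eq_sym.
    - by rewrite idz ltnS; apply: le_m Dl c2D.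
  have LC : followed_by t (last B1 l') C.
    by apply/followed_byP; exists m, z; split.
  have [l1 [l2 l12N]] := chains_next r_pi cN LQ CQ LC.
  have l0N' : belast B1 l' ++ [:: last B1 l'] \in N by rewrite cats1 -lastI.
  by have := chains_suffix r_pi cN cN l0N' l12N.
have l_linked C x : C \in l -> x \in C -> linked U d x.
  move=> Cl xC; have xU : x \in U.
    by rewrite -covQ; apply/bigcupP; exists C => //; apply: lQ.
  apply: linkedI => [|z dz zx]; first exact: mind.
  have zm := leq_trans zx (le_m C x Cl xC).
  have [D [c1 [c2 [Dl c1D c2D zc1 zc2]]]] := hull l' B1 d m z sl dB1 mL dz zm.
  exact: linked_in (arcwiseP _ _ (arcQ D (lQ D Dl)) c1 c2 c1D c2D) zc1 zc2.
have l_before C D : C \in l -> D \in l -> C != D -> before t C D \/ before t D C.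
  move: pw => /(pairwiseP set0) pw Cl Dl CD.
  have iC : (index C l < size l)%N by rewrite index_mem.
  have iD : (index D l < size l)%N by rewrite index_mem.
  have [lt|lt|/index_inj E] := ltngtP (index C l) (index D l).
  - by left; have := pw _ _ iC iD lt; rewrite !nth_index.
  - by right; have := pw _ _ iD iC lt; rewrite !nth_index.
  - by rewrite E ?eqxx in CD.
exists d, l, M; split=> //.
- exact: chains_perm eqN cN.
- by move=> C Cl x; apply: l_linked.
(* If [B] lay over [C], noncrossing would put [x], [z] and [y] between two elements of some other
   chain block [D]; but the blocks of a chain do not interleave. *)
- move=> C B Cl BQ CB; apply/underP=> -[x [y [z [xB yB zC xz zy]]]].
  have CQ := lQ C Cl.
  have dx : linked U d x.
    apply: linked_trans (l_linked C z Cl zC) _; rewrite linked_sym.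
    apply: linkedWl (arcwiseP _ _ (arcQ B BQ) x y xB yB) _ _; exact: ltnW.
  have [D [c1 [c2 [Dl c1D c2D c1x xc2]]]] := cover_run x dx.
  have DQ := lQ D Dl.
  have [DB|DB] := eqVneq D B.
    rewrite DB in Dl; case: (l_before C B Cl Dl CB) => [/beforeP lt|/beforeP lt].
      by have := lt _ _ zC xB; rewrite ltnNge (ltnW xz).
    by have := lt _ _ yB zC; rewrite ltnNge (ltnW zy).
  have {}c1x : (idx c1 < idx x)%N.
    exact: (idx_lt D B).
  have {}xc2 : (idx x < idx c2)%N.
    by apply: (idx_lt B D); rewrite // eq_sym.
  have yc2 : (idx y < idx c2)%N.
    have [//|lt|E] := ltngtP (idx y) (idx c2); last first.
      by have /eqP := idx_neq D B c2 y DQ BQ DB c2D yB; rewrite E eqxx.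
    by case: (ncQ D B c1 x c2 y DQ BQ DB).
  have [DC|DC] := eqVneq D C.
    by case: (ncQ D B c1 x z y DQ BQ DB); rewrite // DC.
  case: (l_before C D Cl Dl); first by rewrite eq_sym.
    move/beforeP=> lt; have := lt _ _ zC c1D.
    by rewrite ltnNge (ltnW (ltn_trans c1x xz)).
  move/beforeP=> lt; have := lt _ _ c2D zC.
  by rewrite ltnNge (ltnW (ltn_trans zy yc2)).
(* Conversely, [x] is spanned by some chain block [D], so that [C] is either [D] or under [D]. *)
move=> C CQ x xC dx outC; have [D [c1 [c2 [Dl c1D c2D c1x xc2]]]] := cover_run x dx.
have [<-//|DC] := eqVneq D C.
have /negP[] := outC D (lQ D Dl) ltac:(by rewrite eq_sym).
apply/underP; exists c1, c2, x; split=> //.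
  exact: (idx_lt D C _ _ (lQ D Dl)).
by apply: (idx_lt C D _ _ CQ (lQ D Dl)); rewrite // eq_sym.
Qed.

End RemovalSum.

(** * The weights over all removable subfamilies cancel *)

Section RemovalSumZero.
Variables (V : finType) (t : seq V).
Implicit Types (B C S U : {set V}) (P Q X : {set {set V}}).

Lemma nth_split_index (T : Type) (x0 : T) (l : seq T) i :
  (i < size l)%N -> l = take i l ++ nth x0 l i :: drop i.+1 l.
Proof. by move=> il; rewrite -drop_nth // cat_take_drop. Qed.

(* Deleting the blocks of a maximal chain one at a time splits it in two,    *)
(* which is the recursion of the Catalan numbers.                            *)
Lemma weight_chain_removal R l M : block_family t R -> l != [::] ->
  chains (followed_by t) R (l :: M) ->
  weight t R + \sum_(B <- l) weight t (R :\ B) = 0.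
Proof.
move=> famR l0 cl; have r_pi := followed_by_partial_injection famR.
have lR : {subset l <= R} by move=> B Bl; apply: chains_mem cl (mem_head _ _) Bl.
rewrite (weight_chains famR cl) big_cons.
set c := (\prod_(k <- M) _)%N; pose n := (size l).-1.
have sz : size l = n.+1 by rewrite prednK // lt0n size_eq0.
(* One block fewer flips the sign, and cutting the list at position [i] leaves parts of [i] and
   [n - i] blocks. *)
have term i : (i < n.+1)%N -> weight t (R :\ nth set0 l i) =
    - (-1) ^+ #|R| * (catalan i * catalan (n - i) * c)%N%:Z.
  rewrite -sz => il; set B := nth set0 l i.
  have BR : B \in R by apply/lR/mem_nth.
  have famRB : block_family t (R :\ B) by apply: block_family_sub famR; apply: subsetDl.
  have := cl; rewrite {1}(nth_split_index set0 il) => /(chains_split r_pi) cB.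
  rewrite (weight_chains famRB cB) !big_cons size_take il size_drop sz subSS mulnA.
  by rewrite (cardsD1 B R) BR exprS mulN1r opprK.
rewrite (big_nth set0) big_mkord sz.
rewrite (eq_bigr _ (fun (i : 'I_n.+1) _ => term i (ltn_ord i))).
rewrite -mulr_sumr -(big_morph Posz PoszD (erefl 0%:Z)) -big_distrl /=.
by rewrite catalan_convolution mulNr subrr.
Qed.

(** A removable family meets the outer chain [l] in at most one block. Hence the removable families
    fall into groups, each made of some [X] disjoint from the chain and of all [B |: X] with [B] in
    the chain, and every group sums to 0 by [weight_chain_removal]. *)
Lemma removal_sum U Q : uniq t -> U \subset [set x in t] -> U != set0 ->
  Q \in run_NC t U -> \sum_(X | removable t U Q X) weight t (Q :\: X) = 0.
Proof.
move=> ut sUt U0 QNC; have famQ := run_NC_family sUt QNC.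
have r_pi := followed_by_partial_injection famQ.
have [d [l [M [cl l0 arcl outl inl]]]] := outer_chain ut sUt U0 QNC.
pose K := [set B in l]; pose F X := weight t (Q :\: X).
have lQ : {subset l <= Q} by move=> B Bl; apply: chains_mem cl (mem_head _ _) Bl.
have remP X := @removableP _ t U Q X sUt QNC.
have nonempty B : B \in Q -> exists x, x \in B.
  by move=> BQ; apply/set0Pn; case: famQ => _ Q0 _; apply: contraNneq Q0 => <-.
have one X B C : removable t U Q X -> B \in X -> C \in X -> B \in K -> C \in K -> B = C.
  move=> /remP[sXQ _ sepX] BX CX; rewrite !inE => Bl Cl.
  have [[b bB] [c cC]] := (nonempty B (lQ B Bl), nonempty C (lQ C Cl)).
  apply: (sepX B C BX CX b c bB cC).
  by apply: linked_trans (arcl C Cl c cC); rewrite linked_sym; apply: arcl bB.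
(* The second sum has exactly one term when [X] meets the chain and none otherwise. *)
have sum_one X : removable t U Q X ->
    F X = (if [disjoint X & K] then F X else 0) + \sum_(B in K | B \in X) F X.
  move=> remX; case: ifP => [dXK|/negbT].
    by rewrite big1 ?addr0 // => B /andP[BK BX]; rewrite (disjointFr dXK BX) in BK.
  rewrite -setI_eq0 => /set0Pn[B]; rewrite inE => /andP[BX BK].
  rewrite add0r (big_pred1 B) // => C /=; apply/andP/eqP=> [[CK CX]|->//].
  exact: one remX CX BX CK BK.
rewrite (eq_bigr _ sum_one) big_split /= -big_mkcondr /=.
have -> : \sum_(X | removable t U Q X) \sum_(B in K | B \in X) F X =
   \sum_(X | removable t U Q X && [disjoint X & K]) \sum_(B in K) F (B |: X).
  rewrite (exchange_big_dep (mem K)) /=; last by move=> X B _ /andP[].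
  rewrite exchange_big /=; apply: eq_bigr => B BK.
  rewrite (reindex_onto (fun X => B |: X) (fun X => X :\ B)) /=; last first.
    by move=> X /and3P[_ _ BX]; rewrite setD1K.
  apply: eq_bigl => X; rewrite BK setU11 !andbT /=; move: (BK); rewrite inE => Bl.
  apply/andP/andP=> -[].
    move=> remBX /eqP eqX; have BX : B \notin X by rewrite -eqX !inE eqxx.
    have [sBXQ noBX sepBX] := remP _ remBX.
    have sX : {subset X <= B |: X} by move=> C CX; rewrite inE CX orbT.
    split.
      apply/remP; split; first exact: subset_trans (subsetUr _ _) sBXQ.
        by move=> C D /sX; apply: noBX.
      by move=> C D /sX CX /sX; apply: sepBX CX.
    rewrite disjoint_subset; apply/subsetP=> C CX; apply: contra BX => CK.
    by rewrite -(one _ C B remBX (sX C CX) (setU11 _ _) CK BK).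
  move=> /remP[sXQ noX sepX] dXK.
  have BX : B \notin X by rewrite (disjointFl dXK).
  split; last by rewrite setU1K.
  (* A block of [X] in the run of the chain is under no other block, hence would belong to the
     chain. *)
  have notin C x y : C \in X -> x \in B -> y \in C -> linked t U x y -> False.
    move=> CX xB yC xy; have := disjointFr dXK CX; rewrite inE => /negP[].
    apply: (inl C (subsetP sXQ C CX) y yC).
      exact: linked_trans (arcl B Bl x xB) xy.
    by move=> D DQ CD; apply: noX.
  apply/remP; split.
  - by rewrite subUset sub1set lQ.
  - by move=> C D; rewrite 2!inE => /orP[/eqP->|CX]; [apply: outl|apply: noX].
  move=> C D; rewrite !inE => /orP[/eqP->|CX] /orP[/eqP->|DX] x y xC yD xy //.
  - by case: (notin D x y DX xC yD xy).
  - by case: (notin C y x CX yD xC); rewrite linked_sym.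
  - exact: (sepX C D CX DX x y xC yD xy).
rewrite -big_split /= big1 // => X /andP[remX dXK].
have [sXQ _ _] := remP X remX.
have dXl : [disjoint X & l].
  by rewrite (eq_disjoint_r (B := mem K)) // => B; rewrite inE.
have [M' cM'] := chains_setD r_pi sXQ dXl cl.
have famR : block_family t (Q :\: X) by apply: block_family_sub famQ; apply: subsetDl.
apply: etrans (weight_chain_removal famR l0 cM'); congr (_ + _).
rewrite [RHS]big_uniq /=; last by case: cM' => /uniq_flatten_mem/(_ (mem_head _ _)).
by apply: eq_big => [B|B _]; rewrite ?inE // /F [B |: X]setUC -setDDl.
Qed.

End RemovalSumZero.

(** * Threads in forests *)

Section Walks.
Variable V : finType.
Implicit Types (t p q : seq V) (x y z : V) (e S T U : {set V}) (g : mgraph V).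

Lemma set2_eq x y x' y' : [set x; y] = [set x'; y'] ->
  (x = x' /\ y = y') \/ (x = y' /\ y = x').
Proof.
move=> E; have := set22 x' y'; have := set21 x' y'; rewrite -E.
have := set22 x y; have := set21 x y; rewrite {1 2}E !inE.
move=> /orP[/eqP<-|/eqP<-] /orP[/eqP<-|/eqP<-]; rewrite ?eqxx ?orbb; auto.
  by move=> _ /eqP->; auto.
by move=> /eqP->; auto.
Qed.

Lemma size_steps x p : size (steps x p) = size p.
Proof. exact: size_pairmap. Qed.

Lemma steps_rcons x p y : steps x (rcons p y) = rcons (steps x p) [set last x p; y].
Proof. by rewrite /steps -cats1 pairmap_cat cats1. Qed.

Lemma steps_cat x p q : steps x (p ++ q) = steps x p ++ steps (last x p) q.
Proof. exact: pairmap_cat. Qed.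

Lemma steps_rev x p : steps (last x p) (rev (belast x p)) = rev (steps x p).
Proof.
elim: p x => //= y p IHp x; rewrite !rev_cons steps_rcons IHp; congr rcons.
by case: p {IHp} => [|z p] /=; rewrite ?rev_cons ?last_rcons setUC.
Qed.

(** Each occurrence of an end set gets as its index the number of later occurrences, which keeps
    parallel edges distinct. *)
Lemma lift_edges g (es : seq {set V}) :
  (forall e, count_mem e es <= mult g e)%N ->
  exists2 fs : seq (edge g), map tag fs = es & uniq fs.
Proof.
move=> le_es; suff [fs [defes ufs _]] : exists fs : seq (edge g),
    [/\ map tag fs = es, uniq fs & forall f, f \in fs -> (nat_of_ord (tagged f) < count_mem (tag f) es)%N].
  by exists fs.
elim: es le_es => [|e es IHes] le_es; first by exists [::].
have [e'|fs [defes ufs ltfs]] := IHes; first exact: leq_trans (leq_addl _ _) (le_es e').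
have lt_e : (count_mem e es < mult g e)%N by have := le_es e; rewrite /= eqxx.
pose f0 : edge g := Tagged (fun e => 'I_(mult g e)) (Ordinal lt_e).
exists (f0 :: fs); split=> /=; first by rewrite defes.
  by rewrite ufs andbT; apply/negP=> /ltfs; rewrite /= ltnn.
move=> f; rewrite inE => /orP[/eqP->|ffs] /=; first by rewrite eqxx.
exact: leq_trans (ltfs f ffs) (leq_addl _ _).
Qed.

Lemma edge_tag_inj g (f f' : edge g) :
  (mult g (tag f) <= 1)%N -> tag f = tag f' -> f = f'.
Proof.
case: f f' => [e i] [e' i'] /= le1 E; case: e' / E i' => i'.
congr (existT _ _ _); apply/val_inj.
by case: i => i /= lti; case: i' => i' /= lti'; lia.
Qed.

Lemma rev_walkK g : involutive (@rev_walk V g).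
Proof. by move=> [w1 w2]; congr pair; apply/val_inj; rewrite /= revK. Qed.

Lemma mem_steps x p e : e \in steps x p ->
  exists2 i, (i < size p)%N & e = [set nth x (x :: p) i; nth x p i].
Proof.
case/(nthP set0)=> i; rewrite size_steps => ip <-; exists i => //.
by rewrite /steps (nth_pairmap x).
Qed.

Lemma steps_cover x p z : p != [::] -> z \in x :: p ->
  exists2 e, e \in steps x p & z \in e.
Proof.
elim: p x => // y p IHp x _; rewrite inE => /orP[/eqP->|zp].
  by exists [set x; y]; rewrite ?mem_head // !inE eqxx.
have [p0|p0] := eqVneq p [::].
  exists [set x; y]; first exact: mem_head.
  by move: zp; rewrite p0 !inE => ->; rewrite orbT.
by have [e ep ze] := IHp y p0 zp; exists e; rewrite // inE ep orbT.
Qed.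

Lemma path_edges_infix (a b p : seq V) x :
  exists A B, path_edges (a ++ (x :: p) ++ b) = A ++ steps x p ++ B.
Proof.
case: a => [|z a] /=.
  by exists [::], (steps (last x p) b); rewrite steps_cat.
exists (rcons (steps z a) [set last z a; x]), (steps (last x p) b).
by rewrite steps_cat /= -/(steps x _) steps_cat cat_rcons.
Qed.

Lemma path_edgesP t e : uniq t -> reflect
  (exists x y, [/\ x \in t, y \in t, index y t = (index x t).+1 & e = [set x; y]])
  (e \in path_edges t).
Proof.
case: t => [|x p] ut; first by constructor=> -[x [y []]].
apply: (iffP idP) => [/mem_steps[i ip ->]|[y [z [yt zt yz ->]]]].
  exists (nth x (x :: p) i), (nth x p i); split.
  - by rewrite mem_nth //= ltnS ltnW.
  - by rewrite inE mem_nth ?orbT.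
  - rewrite -[nth x p i]/(nth x (x :: p) i.+1) !index_uniq //=; lia.
  - by [].
have lt : (index y (x :: p) < size p)%N by have := zt; rewrite -index_mem yz.
apply/(nthP set0); exists (index y (x :: p)); first by rewrite size_steps.
rewrite /steps (nth_pairmap x) // nth_index //.
by rewrite -[nth x p _]/(nth x (x :: p) _.+1) -yz nth_index.
Qed.

Lemma path_edges_uniq t : uniq t -> uniq (path_edges t).
Proof.
case: t => [//|x p] ut; apply/(uniqP set0)=> i j.
rewrite !inE !size_steps => ip jp; rewrite /steps !(nth_pairmap x) //.
rewrite -![nth x p _]/(nth x (x :: p) _.+1).
case/set2_eq=> -[/eqP E1 /eqP E2]; move: E1 E2; rewrite !nth_uniq //=; lia.
Qed.

Lemma path_edges_ends t e z : e \in path_edges t -> z \in e -> z \in t.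
Proof.
case: t => // x p /mem_steps[i ip ->]; rewrite !inE => /orP[]/eqP->.
  by rewrite -in_cons mem_nth //= ltnS ltnW.
by rewrite mem_nth ?orbT.
Qed.

Definition forest t U : mgraph V :=
  MGraph U [ffun e : {set V} => if e \subset U then count_mem e (path_edges t) else 0%N].

Lemma mult_forest t U e : uniq t ->
  mult (forest t U) e = ((e \subset U) && (e \in path_edges t)).
Proof.
by move=> ut; rewrite ffunE count_uniq_mem ?path_edges_uniq //; case: ifP.
Qed.

Lemma contr_forest t U S : contr (forest t U) S = forest t (U :\: S).
Proof.
congr MGraph; apply/ffunP=> e; rewrite !ffunE; case: ifP => // sub.
by rewrite (subset_trans sub (subsetDl _ _)).
Qed.

(* In a forest a walk cannot turn back without repeating an edge.            *)
Lemma monotone_walk t x p : uniq t -> uniq (steps x p) ->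
  {subset steps x p <= path_edges t} ->
  path [rel y z | index z t == (index y t).+1] x p \/
  path [rel y z | index y t == (index z t).+1] x p.
Proof.
move=> ut; elim: p x => [|y p IHp] x; first by left.
rewrite /= -/(steps y p) => /andP[xy_p usp] sub.
have := sub _ (mem_head _ _); case/(path_edgesP _ ut)=> a [b [at_ bt ab Exy]].
have {IHp} IH := IHp y usp (fun e ep => sub e (mem_behead (s := _ :: _) ep)).
have xt : x \in t by apply: (path_edges_ends (sub _ (mem_head _ _))); rewrite !inE eqxx.
case: p xy_p usp sub IH => [|z p] xy_p usp sub IH.
  by case: (set2_eq Exy) => -[-> ->]; rewrite ab eqxx; [left|right].
have zt : z \in t.
  apply: (@path_edges_ends t [set y; z]); last by rewrite !inE eqxx orbT.
  by apply: sub; rewrite !inE eqxx orbT.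
have zx : z <> x by move=> zx; move: xy_p; rewrite /= zx setUC mem_head.
have idx_zx : index z t <> index x t by move/index_inj; auto.
move: IH; rewrite /= => IH; move: idx_zx ab.
by case: (set2_eq Exy) => -[<- <-] idx_zx ab; case: IH => /andP[/eqP yz ->];
  rewrite ?andbT; [left|exfalso|exfalso|right]; try lia; apply/andP; split; apply/eqP; lia.
Qed.

Lemma interval_walk t x p :
  path [rel y z | index z t == (index y t).+1] x p -> last x p \in t ->
  [/\ x \in t, index (last x p) t = (index x t + size p)%N
    & x :: p = take (size p).+1 (drop (index x t) t)].
Proof.
elim: p x => [|y p IHp] x /= => [_ xt|/andP[/eqP xy yp] /(IHp y yp)[yt lastE pE]].
  by rewrite addn0 (drop_nth x) ?index_mem //= nth_index // take0.
have xt : x \in t by rewrite -index_mem; move: yt; rewrite -index_mem xy; lia.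
split=> //; first by rewrite lastE xy addnS addSn.
by rewrite (drop_nth x) ?index_mem //= nth_index // -xy pE.
Qed.


(** With [T] equal to [U :\: S], these are the edges of the restriction to [S] of the forest on
    [U]. *)
Definition consecutive t T S e : bool :=
  [exists x in S, exists y in S, [&& e == [set x; y], index x t < index y t
     & [forall z, (index x t < index z t < index y t) ==> (z \in T)]]]%N.

Lemma consecutiveP t T S e : reflect
  (exists x y, [/\ x \in S, y \in S, e = [set x; y], (index x t < index y t)%N
     & forall z, (index x t < index z t)%N -> (index z t < index y t)%N -> z \in T])
  (consecutive t T S e).
Proof.
apply: (iffP 'exists_in_'exists_in_and3P).
  move=> [x xS [y yS [/eqP E xy /forallP btw]]]; exists x, y; split=> // z xz zy.
  by have := btw z; rewrite xz zy.
move=> [x [y [xS yS -> xy btw]]]; exists x => //; exists y => //; split=> //.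
by apply/forallP=> z; apply/implyP=> /andP[]; apply: btw.
Qed.

Lemma walk_determined t U (w w' : walk (forest t U)) : uniq t ->
  w.1 = w'.1 :> seq V -> map tag w.2 = map tag w'.2 -> w = w'.
Proof.
move=> ut; case: w w' => [w1 w2] [w1' w2'] /= E1 E2.
congr pair; apply/val_inj => //=.
apply: inj_map E2 => f f' Ef; apply: (@edge_tag_inj (forest t U)) Ef.
by rewrite mult_forest //; case: (_ && _).
Qed.

Lemma is_thread_rev g T e (w : walk g) : is_thread T e w -> is_thread T e (rev_walk w).
Proof.
rewrite /is_thread /=; case: (w.1 : seq V) => [|x p] //.
case/lastP: p => [|q y] // /and5P[_ /eqP -> /eqP Et uw2 /andP[uin inT]].
rewrite rev_cons rev_rcons /= map_rev Et -steps_rev last_rcons belast_rcons rev_cons.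
rewrite last_rcons !belast_rcons /= rev_uniq uw2 rev_uniq all_rev.
move: uin inT; rewrite belast_rcons /= => -> ->; rewrite eqxx setUC eqxx.
by rewrite -size_eq0 size_rcons.
Qed.

Lemma thread_steps g T e (w : walk g) x p : is_thread T e w ->
  w.1 = x :: p :> seq V -> map tag w.2 = steps x p.
Proof. by rewrite /is_thread => wT E; move: wT; rewrite E => /and5P[_ _ /eqP]. Qed.

Lemma steps_mult g T e (w : walk g) x p e' : is_thread T e w ->
  w.1 = x :: p :> seq V -> e' \in steps x p -> (0 < mult g e')%N.
Proof.
move=> wT E; rewrite -(thread_steps wT E) => /mapP[f _ ->].
by apply: leq_ltn_trans (ltn_ord (tagged f)).
Qed.

Lemma forest_thread t U T e (w : walk (forest t U)) : uniq t -> is_thread T e w ->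
  exists2 w', w' \in [set w; rev_walk w] & exists x q y,
    [/\ w'.1 = x :: rcons q y :> seq V, is_thread T e w', y \in t &
        path [rel y z | index z t == (index y t).+1] x (rcons q y)].
Proof.
move=> ut wT; have: exists x p, w.1 = x :: p :> seq V /\ p != [::].
  by move: wT; rewrite /is_thread; case: (w.1 : seq V) => // x p /andP[]; exists x, p.
move=> [x [p [E1 p0]]]; have Et := thread_steps wT E1.
have sub : {subset steps x p <= path_edges t}.
  move=> e' /(steps_mult wT E1); rewrite mult_forest //.
  by case: (e' \in path_edges t); rewrite ?andbF.
have us : uniq (steps x p).
  rewrite -Et map_inj_uniq; first by move: wT; rewrite /is_thread E1 => /and5P[].
  by move=> f f' Ef; apply: (@edge_tag_inj (forest t U)) Ef; rewrite mult_forest //; case: (_ && _).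
have intp z : z \in x :: p -> z \in t.
  by move=> zp; have [e' /sub] := steps_cover p0 zp; apply: path_edges_ends.
case/lastP: p p0 E1 Et sub us intp => // q y _ E1 Et sub us intp.
case: (monotone_walk ut us sub) => up.
  exists w; first by rewrite !inE eqxx.
  by exists x, q, y; split=> //; apply: intp; rewrite inE mem_rcons mem_head orbT.
exists (rev_walk w); first by rewrite !inE eqxx orbT.
exists y, (rev q), x; split; last first.
- rewrite -(last_rcons x q y) -rev_cons -(belast_rcons x q y).
  by rewrite rev_path; apply: sub_path up.
- exact/intp/mem_head.
- exact: is_thread_rev.
- by rewrite /= E1 rev_cons rev_rcons.
Qed.

(** Read upwards, a thread is the interval of [t] between its ends, and its edges are determined
    because a forest has no parallel edges. *)
Lemma forest_thread_unique t U T e (w w' : walk (forest t U)) : uniq t ->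
  is_thread T e w -> is_thread T e w' -> [set w; rev_walk w] = [set w'; rev_walk w'].
Proof.
move=> ut wT wT'.
have pair_eq (v v' : walk (forest t U)) : v' \in [set v; rev_walk v] ->
    [set v; rev_walk v] = [set v'; rev_walk v'].
  by rewrite !inE => /orP[]/eqP->; rewrite ?rev_walkK // setUC.
have [v vw [x [q [y [E vT yt up]]]]] := forest_thread ut wT.
have [v' vw' [x' [q' [y' [E' vT' yt' up']]]]] := forest_thread ut wT'.
rewrite (pair_eq _ _ vw) (pair_eq _ _ vw'); suff -> : v = v' by [].
have e_ends (u : walk (forest t U)) a p b : is_thread T e u ->
    u.1 = a :: rcons p b :> seq V -> e = [set a; b].
  by rewrite /is_thread => uT Eu; move: uT; rewrite Eu last_rcons => /and5P[_ /eqP].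
have := e_ends _ _ _ _ vT E; rewrite (e_ends _ _ _ _ vT' E').
have [|xt iy pE] := interval_walk up; first by rewrite last_rcons.
have [|xt' iy' pE'] := interval_walk up'; first by rewrite last_rcons.
rewrite !last_rcons !size_rcons in iy iy' pE pE'.
case/set2_eq=> -[Ex Ey]; last by rewrite Ex Ey in iy'; clear - iy iy'; lia.
have Epq : x :: rcons q y = x' :: rcons q' y'.
  rewrite pE pE' Ex; have -> // : size q = size q'.
  by rewrite Ex Ey in iy'; clear - iy iy'; lia.
apply: walk_determined ut _ _; first by rewrite E E' Epq.
by rewrite (thread_steps vT E) (thread_steps vT' E'); case: Epq => -> ->.
Qed.

Lemma card_threads_forest t U T e : uniq t ->
  #|threads (forest t U) T e| = [exists w : walk (forest t U), is_thread T e w].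
Proof.
move=> ut; have [/existsP[w wT]|no] := boolP [exists w : walk (forest t U), is_thread T e w].
  rewrite [RHS]/=; apply/eqP/cards1P; exists [set w; rev_walk w]; apply/setP=> W; rewrite [RHS]in_set1.
  apply/imsetP/eqP=> [[w']|->]; last by exists w; rewrite // inE.
  by rewrite inE => wT' ->; exact: forest_thread_unique ut wT' wT.
apply/eqP; rewrite cards_eq0; apply/eqP/setP=> W; rewrite inE; apply/imsetP=> -[w].
by rewrite inE => wT; case/existsP: no; exists w.
Qed.

Lemma mem_between (a q b : seq V) x y z : uniq (a ++ (x :: rcons q y) ++ b) ->
  (z \in q) = (index x (a ++ (x :: rcons q y) ++ b) < index z (a ++ (x :: rcons q y) ++ b)
               < index y (a ++ (x :: rcons q y) ++ b))%N.
Proof.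
rewrite /= cat_rcons => u.
have ix : index x (a ++ x :: q ++ y :: b) = size a.
  move: u; rewrite cat_uniq /= => /and3P[_ /norP[xa _] _].
  by rewrite index_cat (negPf xa) /= eqxx addn0.
have iy : index y (a ++ x :: q ++ y :: b) = (size a + (size q).+1)%N.
  move: u; rewrite -cat_cons catA cat_uniq => /and3P[_ /= /norP[ya _] _].
  by rewrite index_cat (negPf ya) /= eqxx addn0 size_cat.
rewrite ix iy; apply/idP/idP=> [zq|/andP[az zy]].
  have [za zx] : z \notin a /\ z != x.
    move: u; rewrite cat_uniq /= => /and4P[_ /norP[_ /hasPn za] xq _]; split.
      by apply: za; rewrite mem_cat zq.
    by apply: contraNneq xq => <-; rewrite mem_cat zq.
  rewrite index_cat (negPf za) /= eq_sym (negPf zx) index_cat zq.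
  by move: zq; rewrite -index_mem addnS ltnS leq_addr addnS ltnS ltn_add2l.
move: az zy; rewrite index_cat; case: ifP => [|_].
  by rewrite -index_mem => za /ltnW; rewrite leqNgt za.
rewrite /=; case: eqP => _; first by rewrite addn0 ltnn.
by rewrite index_cat; case: ifP => // _ _; rewrite ltn_add2l ltnS ltnNge leq_addr.
Qed.

Lemma split_between t x y : uniq t -> y \in t -> (index x t < index y t)%N ->
  exists a q b, t = a ++ (x :: rcons q y) ++ b.
Proof.
move=> ut yt xy; have xt : x \in t by move: yt; rewrite -!index_mem; apply: ltn_trans.
case/splitPr: xt ut yt xy => a c ut; rewrite mem_cat inE => yt xy.
have {yt} yc : y \in c.
  case/or3P: yt xy ut => // [ya|/eqP->]; last by rewrite ltnn.
  rewrite cat_uniq /= => xy /and3P[_ /norP[xa _] _].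
  move: xy; rewrite !index_cat (negPf xa) ya /= eqxx addn0 => lt.
  by move: ya; rewrite -index_mem ltnNge (ltnW lt).
by case/splitPr: yc => q b; exists a, q, b; rewrite /= cat_rcons.
Qed.

Lemma mult_restr_forest t U S e : uniq t -> U \subset [set x in t] -> S \subset U ->
  mult (restr (forest t U) S) e = consecutive t (U :\: S) S e.
Proof.
move=> ut sUt sSU; rewrite ffunE card_threads_forest //=.
case: ifPn => eS; last first.
  apply/esym/eqP; rewrite eqb0; apply: contra eS => /consecutiveP[x [y [xS yS -> _ _]]].
  by rewrite subUset !sub1set xS.
congr nat_of_bool; apply/existsP/consecutiveP => [[w wT]|[x [y [xS yS Ee xy btw]]]].
  have [w' _ [x [q [y [E wT' yt up]]]]] := forest_thread ut wT.
  have [|xt iy pE] := interval_walk up; first by rewrite last_rcons.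
  rewrite last_rcons size_rcons in iy pE.
  move: wT'; rewrite /is_thread E last_rcons belast_rcons /=.
  case/and5P=> _ /eqP Ee _ _ /andP[_ /allP qT].
  move: eS; rewrite Ee subUset !sub1set => /andP[xS yS].
  exists x, y; split=> //; first by rewrite iy; lia.
  have tE : t = take (index x t) t ++ (x :: rcons q y) ++ drop (size q).+2 (drop (index x t) t).
    by rewrite pE !cat_take_drop.
  move=> z xz zy; apply: qT; rewrite tE in ut; rewrite (mem_between z ut) -tE.
  by rewrite xz.
have yt : y \in t by have := subsetP sUt y (subsetP sSU y yS); rewrite inE.
have [a [q [b tE]]] := split_between ut yt xy.
have qT z : z \in q -> z \in U :\: S.
  move=> zq; have := zq; rewrite tE in ut; rewrite (mem_between z ut) -tE.
  by case/andP; apply: btw.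
have [A [B AB]] := path_edges_infix a b (rcons q y) x.
have uAB := path_edges_uniq ut; rewrite tE AB in uAB.
have us : uniq (steps x (rcons q y)).
  by move: uAB; rewrite cat_uniq => /and3P[_ _]; rewrite cat_uniq => /and3P[].
have [fs fsE ufs] : exists2 fs : seq (edge (forest t U)), map tag fs = steps x (rcons q y) & uniq fs.
  apply: lift_edges => e'; rewrite count_uniq_mem // mult_forest //.
  case e's: (e' \in steps _ _) => //=; rewrite lt0b.
  have e't : e' \in path_edges t by rewrite tE AB !mem_cat e's orbT.
  rewrite e't andbT; apply/subsetP=> v ve'.
  have: v \in x :: rcons q y.
    have [i ip E'] := mem_steps e's; move: ve'; rewrite E' !inE => /orP[]/eqP->.
      by rewrite -in_cons mem_nth //= ltnS ltnW.
    by rewrite mem_nth ?orbT.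
  rewrite inE mem_rcons inE => /or3P[/eqP->|/eqP->|/qT].
  - exact: subsetP sSU x xS.
  - exact: subsetP sSU y yS.
  - by rewrite inE => /andP[].
(* The remaining bounds make the interval fit into the bounded sequences of [walk]. *)
have szt : (size t <= #|V|)%N by rewrite -(card_uniqP ut) max_card.
have sz1 : (size (x :: rcons q y) <= #|V|.+1)%N.
  by apply: leqW (leq_trans _ szt); rewrite tE !size_cat; lia.
have sz2 : (size fs <= #|V|)%N.
  by rewrite -(size_map tag) fsE size_steps; move: sz1; rewrite /= ltnS.
exists (Bseq sz1, Bseq sz2); rewrite /is_thread /= last_rcons belast_rcons /=.
rewrite Ee eqxx fsE eqxx ufs -size_eq0 size_rcons /=.
apply/andP; split; last by apply/allP=> z /qT.
move: ut; rewrite tE !cat_uniq => /and3P[_ _ /and3P[]].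
by rewrite /= rcons_uniq => /and3P[].
Qed.

End Walks.

(** * The antipode of a forest *)

Lemma mulr_sumZr (K : pzRingType) (L : algType K) (J : finType) (P : pred J)
    (c : J -> K) (f : J -> L) (v : L) :
  v * (\sum_(i | P i) c i *: f i) = \sum_(i | P i) c i *: (v * f i).
Proof. by rewrite mulr_sumr; apply: eq_bigr => i _; rewrite scalerAr. Qed.

Section ForestAntipode.
Variable V : finType.
Implicit Types (t : seq V) (x y z : V) (e B S T U : {set V}) (g h : mgraph V).

Lemma mgraphP g h : verts g = verts h -> mult g =1 mult h -> g = h.
Proof. by case: g h => [U m] [U' m'] /= -> /ffunP->. Qed.

Lemma verts_big (I : Type) (r : seq I) (P : pred I) (F : I -> mgraph V) :
  verts (\big[mmul/mone]_(i <- r | P i) F i) = \bigcup_(i <- r | P i) verts (F i).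
Proof. exact: (big_morph (@verts V) (fun _ _ => erefl) erefl). Qed.

Lemma mult_big (I : Type) (r : seq I) (P : pred I) (F : I -> mgraph V) e :
  mult (\big[mmul/mone]_(i <- r | P i) F i) e = (\sum_(i <- r | P i) mult (F i) e)%N.
Proof.
by apply: (big_morph (fun g => mult g e)) => [g h|]; rewrite ffunE.
Qed.

Lemma malgU_mul (K : fieldType) g h :
  << mmul g h >> = << g >> * << h >> :> {malg K[mgraph V]}.
Proof. by rewrite malgM_def fgmulUU mulr1. Qed.

Lemma malgU_big (K : fieldType) (I : Type) (r : seq I) (P : pred I) (F : I -> mgraph V) :
  << \big[mmul/mone]_(i <- r | P i) F i >> =
  \prod_(i <- r | P i) << F i >> :> {malg K[mgraph V]}.
Proof. exact: (big_morph (fun g => << g >>) (@malgU_mul K) erefl). Qed.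

Lemma consecutive_subset t T S e : consecutive t T S e -> e \subset S.
Proof. by case/consecutiveP=> x [y [xS yS -> _ _]]; rewrite subUset !sub1set xS. Qed.

Lemma index_eq t x z : x \in t -> index z t = index x t -> z = x.
Proof.
move=> xt E; apply: (@index_inj _ x t) => //.
by rewrite -index_mem E index_mem.
Qed.

(** The ends of an edge and all that lies between them are in one run, hence in one piece; and no
    other piece has an element between two elements of that piece. *)
Lemma restr_forest_pieces t U S : uniq t -> U \subset [set x in t] -> S \subset U ->
  restr (forest t U) S = \big[mmul/mone]_(B in pieces t U S) restr (forest t U) B.
Proof.
move=> ut sUt sSU; have partS := pieces_partition sUt sSU.
have [/eqP covS trivS S0] := and3P partS.
apply: mgraphP => [|e]; first by rewrite verts_big -[LHS]covS.
have sBU B : B \in pieces t U S -> B \subset U.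
  by move=> BS; apply: subset_trans sSU; rewrite -covS; apply: bigcup_sup.
rewrite mult_big mult_restr_forest //.
under eq_bigr => B BS do rewrite mult_restr_forest ?sBU //.
have [arcS sepS] := elimT (pieces_cover t U trivS S0) ltac:(by rewrite covS).
have inS B x : B \in pieces t U S -> x \in B -> x \in S.
  by move=> BS xB; rewrite -covS; apply/bigcupP; exists B.
case: (boolP (consecutive t _ S e)) => [/consecutiveP[x [y [xS yS Ee xy btw]]]|no]; last first.
  rewrite big1 // => B BS; apply/eqP; rewrite eqb0; apply: contra no.
  case/consecutiveP=> x [y [xB yB Ee xy btw]]; apply/consecutiveP.
  exists x, y; split=> //; rewrite ?(inS B) // => z xz zy.
  have := btw z xz zy; rewrite !inE => /andP[zB ->]; rewrite andbT.
  apply: contra zB; rewrite -{1}covS => /bigcupP[C CS zC].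
  rewrite (sepS B C BS CS x z xB zC) //.
  by apply: linkedWl (arcwiseP _ _ _ (arcS B BS) x y xB yB) _ _; apply: ltnW.
have [xU yU] := (subsetP sSU x xS, subsetP sSU y yS).
have lxy : linked t U x y.
  apply: linkedI => [|z xz zy]; first exact: ltnW.
  have [->//|zx] := eqVneq z x; have [->//|zNy] := eqVneq z y.
  have: z \in U :\: S; last by rewrite inE => /andP[].
  have [xt yt] : x \in t /\ y \in t.
    by have := subsetP sUt x xU; have := subsetP sUt y yU; rewrite !inE.
  apply: btw; rewrite ltn_neqAle ?xz ?zy andbT.
    by apply: contraNneq zx => E; apply/eqP/(index_eq xt).
  by apply: contraNneq zNy => E; apply/eqP/(index_eq yt).
have: x \in cover (pieces t U S) by rewrite covS.
case/bigcupP=> B BS xB; have: y \in cover (pieces t U S) by rewrite covS.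
case/bigcupP=> C CS; move=> yB; move: (yB); rewrite -(sepS B C BS CS x y xB yB lxy) => {}yB.
rewrite (bigD1 B) //= big1 => [|D /andP[DS DB]].
  rewrite addn0; apply/esym/eqP; rewrite eqb1; apply/consecutiveP.
  exists x, y; split=> // z xz zy; have := btw z xz zy; rewrite !inE => /andP[zS ->].
  by rewrite andbT; apply: contra zS; apply: inS BS.
apply/eqP; rewrite eqb0; apply: contra DB => /consecutive_subset.
rewrite Ee subUset !sub1set => /andP[xD _].
by rewrite (sepS D B DS BS x x xD xB) // linked_refl.
Qed.

(** Everything between two elements of [B] lies in [U :\: S], so no thread meets [S]. The graph of a
    block thus does not depend on what was removed earlier. *)
Lemma restr_forest_local t U S B : uniq t -> U \subset [set x in t] ->
  B \subset U :\: S -> arcwise t (U :\: S) B ->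
  restr (forest t (U :\: S)) B = restr (forest t U) B.
Proof.
move=> ut sUt sBU arcB; have sUSU : U :\: S \subset U by apply: subsetDl.
apply: mgraphP => // e; rewrite !mult_restr_forest //; first last.
- exact: subset_trans sUSU sUt.
- exact: subset_trans sBU sUSU.
congr nat_of_bool; apply/consecutiveP/consecutiveP.
  move=> [x [y [xB yB Ee xy btw]]]; exists x, y; split=> // z xz zy.
  by have := btw z xz zy; rewrite !inE => /and3P[-> _ ->].
move=> [x [y [xB yB Ee xy btw]]]; exists x, y; split=> // z xz zy.
have := btw z xz zy; rewrite inE => /andP[zB _]; rewrite inE zB /=.
apply: linked_in (arcwiseP _ _ _ arcB x y xB yB) _ _; exact: ltnW.
Qed.

Lemma forest0 t : uniq t -> forest t set0 = mone.
Proof.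
move=> ut; apply: mgraphP => // e; rewrite !ffunE subset0; case: eqP => // ->.
rewrite count_uniq_mem ?path_edges_uniq //; case: path_edgesP => // -[x [y [_ _ _ E]]].
by have := set21 x y; rewrite -E inE.
Qed.

Lemma mult_forest_cons x t U e : uniq (x :: t) ->
  mult (forest (x :: t) U) e =
  ([&& x \in U, (if t is y :: _ then y \in U else false)
     & e == [set x; head x t]] + mult (forest t (U :\ x)) e)%N.
Proof.
move=> /= /andP[xt ut]; rewrite !ffunE.
have -> : count_mem e (path_edges (x :: t)) =
    ((if t is y :: _ then e == [set x; y] else false) + count_mem e (path_edges t))%N.
  by case: t {xt ut} => //= y t; rewrite eq_sym.
rewrite subsetD1; have [eU|eU] /= := boolP (e \subset U); last first.
  rewrite addn0; case: t {xt ut} => [|y t] /=; first by rewrite andbF.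
  apply/esym/eqP; rewrite eqb0; apply: contra eU => /and3P[xU yU /eqP->].
  by rewrite subUset !sub1set xU.
have -> : (if x \notin e then count_mem e (path_edges t) else 0)%N = count_mem e (path_edges t).
  case: ifP => // /negbFE xe; apply/esym/count_memPn.
  by apply: contra xt => et; apply: path_edges_ends et xe.
congr (_ + _)%N; case: t {xt ut} => [|y t] /=; first by rewrite andbF.
congr nat_of_bool.
by apply/idP/and3P=> [/eqP E|[]//]; move: eU; rewrite E subUset !sub1set => /andP[-> ->].
Qed.

(** The last clause strengthens the induction: if the next vertex is in [U], its component comes
    first in the list and starts with it, so the new vertex can be put in front. *)
Lemma forest_components t U : uniq t -> U \subset [set x in t] ->
  exists cs : seq (bool * seq V),
    [/\ all (fun c => c.2 != [::]) cs, uniq (flatten (unzip2 cs)),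
        [set x in flatten (unzip2 cs)] = U,
        forest t U = \big[mmul/mone]_(c <- cs) component c
      & forall y t', t = y :: t' -> y \in U -> exists q cs', cs = (false, y :: q) :: cs'].
Proof.
elim: t U => [|x t IHt] U.
  move=> _ sU; have -> : U = set0.
    by apply/setP=> x; rewrite inE; apply/negP=> /(subsetP sU); rewrite inE.
  exists [::]; split; [by []|by []| | |by []].
    by apply/setP=> x; rewrite !inE.
  by rewrite big_nil; apply: forest0.
move=> uxt sUt; have /andP[xt ut] := uxt.
have sU't : U :\ x \subset [set x in t].
  apply/subsetP=> y; rewrite !inE => /andP[yx /(subsetP sUt)].
  by rewrite !inE (negPf yx).
have [cs [cs0 ucs Ucs Fcs headcs]] := IHt (U :\ x) ut sU't.
have [xU|xU] := boolP (x \in U); last first.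
  have U'U : U :\ x = U by apply/setP=> y; rewrite !inE; case: eqP => // ->; rewrite (negPf xU).
  exists cs; split; [by []|by []|by rewrite Ucs| |by move=> y t' [<- _]; rewrite (negPf xU)].
  by rewrite -Fcs U'U; apply: mgraphP => // e; rewrite mult_forest_cons // (negPf xU) U'U.
have memcs y : (y \in flatten (unzip2 cs)) = (y \in U :\ x) by rewrite -Ucs inE.
have xcs : x \notin flatten (unzip2 cs) by rewrite memcs !inE eqxx.
have [[y [t' [tE yU]]]|no] :
    (exists y t', t = y :: t' /\ y \in U) \/ (if t is y :: _ then y \in U else false) = false.
  case: (t) => [|y t']; first by right.
  by case E: (y \in U); [left; exists y, t'|right].
  have yx : y != x by apply: contraNneq xt => <-; rewrite tE mem_head.
  have [|q [cs' csE]] := headcs y t' tE; first by rewrite !inE yx.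
  exists ((false, x :: y :: q) :: cs'); split; last by move=> z t'' [<- _] _; exists (y :: q), cs'.
  - by move: cs0; rewrite csE.
  - by move: ucs xcs; rewrite csE /= => -> ->.
  - apply/setP=> z; rewrite inE /= inE; have := memcs z; rewrite csE /= => ->.
    by rewrite !inE; case: eqP => [->|].
  apply: mgraphP => [|e].
    rewrite big_cons /= -[LHS](setD1K xU) -[U :\ x]/(verts (forest t (U :\ x))) Fcs csE big_cons.
    by apply/setP=> z; rewrite !inE !orbA.
  rewrite mult_forest_cons // Fcs csE !big_cons /= !ffunE xU tE yU /=.
  by rewrite addnA eq_sym.
exists ((false, [:: x]) :: cs); split; last by move=> z t'' [<- _] _; exists [::], cs.
- by rewrite /= cs0.
- by rewrite /= xcs.
- by apply/setP=> z; rewrite inE /= inE memcs !inE; case: eqP => [->|].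
apply: mgraphP => [|e].
  rewrite big_cons /= -[LHS](setD1K xU) -[U :\ x]/(verts (forest t (U :\ x))) Fcs.
  by congr (_ :|: _); apply/setP=> z; rewrite !inE.
by rewrite mult_forest_cons // no andbF Fcs big_cons /= !ffunE.
Qed.

Lemma inC_forest t U : uniq t -> U \subset [set x in t] -> inC U (forest t U).
Proof.
by move=> ut sUt; have [cs [? ? ? ? _]] := forest_components ut sUt; exists cs.
Qed.

Variables (K : fieldType).
Variable (A : {set V} -> {linear {malg K[mgraph V]} -> {malg K[mgraph V]}}).
Hypothesis antipodeA : is_antipode A.

Lemma removable_cover t U Q (X : {set {set V}}) : removable t U Q X -> cover X \subset U.
Proof.
case/and3P=> _ _ /eqP pX; apply/subsetP=> x /bigcupP[B]; rewrite -{1}pX => /imsetP[z _ ->].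
by rewrite inE => /andP[_ /linkedr].
Qed.

Lemma malgU_restr_forest t U S : uniq t -> U \subset [set x in t] -> S \subset U ->
  << restr (forest t U) S >> =
  \prod_(B in pieces t U S) << restr (forest t U) B >> :> {malg K[mgraph V]}.
Proof.
by move=> ut sUt sSU; rewrite [in LHS](restr_forest_pieces ut sUt sSU); apply: malgU_big.
Qed.

(** For nonempty [S] this is the term of the recursion with the inductive value inserted, and for
    [S] empty it is the claimed antipode; the claim becomes that all these terms sum to 0. *)
Definition recursion_term t U S : {malg K[mgraph V]} :=
  \sum_(P in run_NC t (U :\: S)) (weight t P)%:~R *:
    (<< restr (forest t U) S >> * \prod_(B in P) << restr (forest t U) B >>).

Lemma forest_antipode t U : uniq t -> U \subset [set x in t] ->
  A U << forest t U >> = \sum_(P in run_NC t U)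
    (weight t P)%:~R *: \prod_(B in P) << restr (forest t U) B >>.
Proof.
move=> ut; have [n] := ubnP #|U|; elim: n U => // n IHn U leU sUt.
have [A0 AI] := antipodeA.
pose G := recursion_term t U.
have G0 : G set0 = \sum_(P in run_NC t U)
    (weight t P)%:~R *: \prod_(B in P) << restr (forest t U) B >>.
  rewrite /G /recursion_term setD0 (malgU_restr_forest ut sUt (sub0set U)).
  have -> : pieces t U set0 = set0 by apply: imset0.
  rewrite big_set0; apply: eq_bigr => P _; congr (_ *: _); exact: mul1r.
rewrite -G0; have [U0|U0] := eqVneq U set0.
  rewrite G0 U0 A0; last by rewrite -U0; apply: inC_forest.
  rewrite (big_pred1 set0) => [|P]; last first.
    apply/run_NCP/eqP=> [[/and3P[/eqP covP _ P0] _ _]|->].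
      have [//|[B BP]] := set_0Vmem P; have B0 : B = set0.
        by apply/eqP; rewrite -subset0 -covP; apply: bigcup_sup.
      by rewrite -B0 BP in P0.
    split; last by move=> B; rewrite inE.
      apply/and3P; split; last by rewrite inE.
        by rewrite /cover big_set0.
      by apply/trivIsetP=> B C; rewrite inE.
    by apply/noncrossingP=> B C a b c d; rewrite inE.
  rewrite big_set0 /weight /merge_closure cards0 /= big_set0 expr0 mul1r scale1r.
  by rewrite forest0.
rewrite (AI U _ U0 (inC_forest ut sUt)).
apply/eqP; rewrite eq_sym -subr_eq0 opprK; apply/eqP.
transitivity (\sum_(S : {set V} | S \subset U) G S).
  rewrite [RHS](bigD1 set0); last exact: sub0set.
  congr (_ + _); apply: eq_bigr => S /andP[sSU S0]; rewrite /G /recursion_term.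
  rewrite contr_forest (IHn (U :\: S)); first last.
  - exact: subset_trans (subsetDl _ _) sUt.
  - have := leU; rewrite ltnS; apply: leq_trans; rewrite cardsD (setIidPr sSU).
    by rewrite ltn_subrL !card_gt0 S0.
  rewrite [LHS]mulr_sumZr; apply: eq_bigr => P PNC.
  apply: (congr1 (fun v => _ *: (_ * v))).
  have [/and3P[/eqP covP _ _] _ arcP] := run_NCP _ _ _ PNC.
  apply: eq_bigr => B BP; apply: (congr1 (fun g => << g >>)).
  apply: (restr_forest_local ut sUt _ (arcP B BP)).
  by rewrite -covP; apply: bigcup_sup.
under eq_bigr do rewrite /G /recursion_term.
rewrite pair_big_dep /=.
(* The pair of [S] and [P] is encoded by [X], the pieces of [S], and [Q], the union of [X] and [P];
   it is recovered as [cover X] and [Q :\: X]. *)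
rewrite (reindex_onto
  (fun QX : {set {set V}} * {set {set V}} => (cover QX.2, QX.1 :\: QX.2))
  (fun SP : {set V} * {set {set V}} => (pieces t U SP.1 :|: SP.2, pieces t U SP.1))) /=; last first.
  move=> [S P] /= /andP[sSU PNC].
  have [/and3P[/eqP covP _ P0] _ _] := run_NCP _ _ _ PNC.
  have [/eqP covS _ _] := and3P (pieces_partition sUt sSU).
  rewrite covS; apply: (congr1 (pair S)); apply/setP=> B; rewrite in_setD in_setU.
  have [BS|_] := boolP (B \in pieces _ _ _); last by rewrite orFb.
  rewrite andFb; apply/esym/negP=> BP.
  have [x xB] : exists x, x \in B by apply/set0Pn; apply: contraNneq P0 => <-.
  have: x \in U :\: S by rewrite -covP; apply/bigcupP; exists B.
  by rewrite inE => /andP[/negP[]]; rewrite -covS; apply/bigcupP; exists B.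
transitivity (\sum_Q \sum_(X | removable t U Q X)
    (weight t (Q :\: X))%:~R *: \prod_(B in Q) << restr (forest t U) B >> : {malg K[mgraph V]}).
  rewrite pair_big_dep /=; apply: eq_big => [[Q X] /=|[Q X] /= /andP[/andP[sXU _] /eqP[E1 E2]]].
    apply/andP/idP=> [[/andP[sXU QX] /eqP[E1 E2]]|remX].
      have sXQ := subsetUl (pieces t U (cover X)) (Q :\: X); rewrite E1 E2 in sXQ.
      by apply/and3P; split; [exact: sXQ|exact: QX|apply/eqP].
    have [sXQ QX /eqP pX] := and3P remX; rewrite QX (removable_cover remX) pX.
    split; first by [].
    by rewrite setDE setUIr setUCr setIT (setUidPr sXQ).
  rewrite (malgU_restr_forest ut sUt sXU) E2.
  have sXQ := subsetUl (pieces t U (cover X)) (Q :\: X); rewrite E1 E2 in sXQ.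
  by rewrite [in RHS](big_setID X) /= (setIidPr sXQ).
apply: big1 => Q _; rewrite -scaler_suml -rmorph_sum /=.
have [QNC|QNC] := boolP (Q \in run_NC t U); first by rewrite (removal_sum ut sUt U0 QNC) scale0r.
(* A [Q] outside [run_NC t U] has no removable subfamily. *)
rewrite big_pred0; first by rewrite scale0r.
by move=> X; apply: contraNF QNC; apply: removable_run_NC.
Qed.

End ForestAntipode.

(** * Cutting a cycle open at the zero block *)

Section Cycles.
Variable V : finType.
Implicit Types (s t p q : seq V) (x y z : V) (e B S T U : {set V}).

Lemma cycle_edges_rot k s : perm_eq (cycle_edges (rot k s)) (cycle_edges s).
Proof.
have rot1 u : perm_eq (cycle_edges (rot 1 u)) (cycle_edges u).
  case: u => // x [|y p] //; rewrite rot1_cons /=.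
  by rewrite steps_rcons last_rcons perm_rcons.
elim: k => [|k IHk]; first by rewrite rot0.
have [lt|le] := ltnP k (size s); last by rewrite rot_oversize // ltnW.
by rewrite rotS //; apply: perm_trans IHk.
Qed.

Lemma cycle_graph_rot k s : cycle_graph (rot k s) = cycle_graph s.
Proof.
apply: mgraphP => [|e] /=; first by apply/setP=> x; rewrite !inE mem_rot.
by rewrite !ffunE; apply/permP/cycle_edges_rot.
Qed.

(** The same rotation as in [adjacent_closure], with [S] as the zero block. *)
Definition start_in S s := rot (find (mem S) s) s.

Lemma start_in_cons S s : S \subset [set x in s] -> S != set0 ->
  exists x p, x \in S /\ start_in S s = x :: p.
Proof.
move=> sSs /set0Pn[x xS]; have hasS : has (mem S) s.
  by apply/hasP; exists x; rewrite //; have := subsetP sSs x xS; rewrite inE.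
exists (nth x s (find (mem S) s)); rewrite /start_in /rot (drop_nth x) -?has_find //=.
by eexists; split; [apply: (nth_find x hasS)|reflexivity].
Qed.

(** The closing edge is the only one that the path on the rotated sequence lacks, and it contains
    the first vertex, which is in [S]. *)
Lemma contr_cycle S s : uniq s -> S \subset [set x in s] -> S != set0 ->
  contr (cycle_graph s) S = forest (start_in S s) ([set x in s] :\: S).
Proof.
move=> us sSs S0; have [x [p [xS tE]]] := start_in_cons sSs S0.
rewrite -(cycle_graph_rot (find (mem S) s) s) -/(start_in S s) tE.
have memt : [set y in x :: p] = [set y in s].
  by apply/setP=> y; rewrite !in_set -tE mem_rot.
apply: mgraphP => [|e] /=; first by rewrite memt.
rewrite !ffunE /= memt; case: ifP => // /subsetP sub.
rewrite steps_rcons -cats1 count_cat /= addn0 [X in (_ + X)%N](_ : _ = 0%N) ?addn0 //.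
apply/eqP; rewrite eqb0; apply/eqP=> E.
by have := sub x; rewrite -E !inE eqxx orbT xS => /(_ isT).
Qed.

Lemma index_rot k s z : uniq s -> (k <= size s)%N -> z \in s ->
  (index z (rot k s) + k = index z s /\ index z (rot k s) < size s - k)%N \/
  (index z (rot k s) = size s - k + index z s /\ index z s < k)%N.
Proof.
move=> us ks zs; have us' := us; rewrite -(cat_take_drop k s) cat_uniq in us'.
case/and3P: us' => _ /hasPn disj _.
have zE : (z \in take k s) || (z \in drop k s) by rewrite -mem_cat cat_take_drop.
have sz : size (take k s) = k by rewrite size_takel.
have is_ : index z s = if z \in take k s then index z (take k s) else (k + index z (drop k s))%N.
  by rewrite -{1}(cat_take_drop k s) index_cat sz.
rewrite is_ /rot index_cat size_drop; have [zd|zd] := boolP (z \in drop k s).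
  left; rewrite (negPf (disj z zd)) addnC; split=> //.
  by rewrite -size_drop index_mem.
right; rewrite (negPf zd) orbF in zE; rewrite zE; split=> //.
by rewrite -{2}sz index_mem.
Qed.

Lemma noncrossing_rot k s (P : {set {set V}}) : uniq s -> cover P \subset [set x in s] ->
  noncrossing s P -> noncrossing (rot k s) P.
Proof.
move=> us /subsetP sPs ncs; have [sk|ks] := leqP (size s) k; first by rewrite rot_oversize.
move/noncrossingP: ncs => nc; apply/noncrossingP=> B C a b c d BP CP BC aB bC cB dC.
have pos D z : D \in P -> z \in D ->
  (index z (rot k s) + k = index z s /\ index z (rot k s) < size s - k)%N \/
  (index z (rot k s) = size s - k + index z s /\ index z s < k)%N.
  move=> DP zD; apply: index_rot => //; first exact: ltnW.
  by have := sPs z; rewrite inE; apply; apply/bigcupP; exists D.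
have CB : C != B by rewrite eq_sym.
(* A crossing after the rotation is, in [s], one of the four cyclic shifts of itself, depending on
   where [s] starts. *)
have nc1 := nc B C a b c d BP CP BC aB bC cB dC.
have nc2 := nc C B d a b c CP BP CB dC aB bC cB.
have nc3 := nc B C c d a b BP CP BC cB dC aB bC.
have nc4 := nc C B b c d a CP BP CB bC cB dC aB.
move: nc1 nc2 nc3 nc4 (pos B a BP aB) (pos C b CP bC) (pos B c BP cB) (pos C d CP dC).
move: (index a _) (index b _) (index c _) (index d _) => a' b' c' d'.
move: (index a s) (index b s) (index c s) (index d s) => a1 b1 c1 d1.
move: (size s) ks; clear => n ks nc1 nc2 nc3 nc4.
move=> [[a2 a3]|[a2 a3]] [[b2 b3]|[b2 b3]] [[c2 c3]|[c2 c3]] [[d2 d3]|[d2 d3]] ab bc cd;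
  solve [apply: nc1; lia | apply: nc2; lia | apply: nc3; lia | apply: nc4; lia | lia].
Qed.

Lemma rot_rot_inv k s : exists k', rot k' (rot k s) = s.
Proof. by exists (size (rot k s) - k)%N; apply: rotK. Qed.

(** As the rotated sequence starts in [S], a block with an element of [S] between two of its own
    would cross [S]. Not crossing [S] therefore amounts to being [arcwise] off [S]. *)
Lemma PNCP s S P : uniq s ->
  ((S, P) \in PNC s) = [&& S \subset [set x in s], S != set0 &
                          P \in run_NC (start_in S s) ([set x in s] :\: S)].
Proof.
move=> us; set I := [set x in s]; set t := start_in S s.
have ut : uniq t by rewrite rot_uniq.
have memt z : (z \in t) = (z \in s) by rewrite mem_rot.
rewrite inE /=; apply/and3P/and3P => [[SP part nc]|[sSI S0 PNC]].
  rewrite -/I in part; have [/eqP cov triv P0] := and3P part.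
  have S0 : S != set0 by apply: contraNneq P0 => ->; rewrite setU11.
  have sSI : S \subset I by rewrite -cov; apply: bigcup_sup; rewrite setU11.
  have [x0 [p [x0S tE]]] := start_in_cons sSI S0.
  have /noncrossingP nct : noncrossing t (S |: P).
    by apply: noncrossing_rot => //; rewrite cov.
  split; [by []|by []|]; apply/run_NCP; split.
  - by have := partitionD1 part (setU11 S P); rewrite setU1K.
  - by apply: (noncrossingS (subsetUr [set S] P)); apply/noncrossingP.
  move=> B BP; have BQ : B \in S |: P by rewrite setU1r.
  have BS : S != B by apply: contraNneq SP => ->.
  have disj : [disjoint S & B] := trivIsetP triv _ _ (setU11 _ _) BQ BS.
  apply/arcwiseP.
  suff le x y : x \in B -> y \in B -> (index x t <= index y t)%N -> linked t (I :\: S) x y.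
    move=> x y xB yB; have [|/ltnW] := leqP (index x t) (index y t); first exact: le.
    by rewrite linked_sym; apply: le.
  move=> xB yB xy; apply: linkedI => // z xz zy.
  have yI : y \in I by rewrite -cov; apply/bigcupP; exists B.
  have ys : y \in s by rewrite inE in yI.
  have zt : z \in t by rewrite -index_mem; apply: leq_ltn_trans zy _; rewrite index_mem memt.
  rewrite !inE -memt zt andbT; apply/negP=> zS.
  have neq v : v \in B -> index z t != index v t.
    move=> vB; apply/eqP => E; have vt : v \in t.
      have: v \in I by rewrite -cov; apply/bigcupP; exists B.
      by rewrite inE memt.
    by have := disjointFr disj zS; rewrite (index_eq vt E) vB.
  have x0x : (index x0 t < index x t)%N.
    have x0t : index x0 t = 0%N by rewrite /t tE /= eqxx.
    rewrite x0t lt0n; apply/eqP=> E; rewrite -x0t in E.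
    have x0t' : x0 \in t by rewrite /t tE mem_head.
    by have := disjointFr disj x0S; rewrite -(index_eq x0t' E) xB.
  apply: (nct S B x0 x z y (setU11 _ _) BQ BS x0S xB zS yB x0x).
    by rewrite ltn_neqAle eq_sym neq.
  by rewrite ltn_neqAle neq.
have [part /noncrossingP ncP arcP] := run_NCP _ _ _ PNC; have [/eqP cov _ _] := and3P part.
have SP : S \notin P.
  apply/negP=> SP; have /set0Pn[x xS] := S0.
  have: x \in I :\: S by rewrite -cov; apply/bigcupP; exists S.
  by rewrite inE xS.
have part' : partition (S |: P) I.
  have disj : [disjoint S & I :\: S] by rewrite -setI_eq0 setDE setICA setICr setI0.
  have := partitionU1 part S0 disj.
  by rewrite setDE setUIr setUCr setIT (setUidPr sSI).
split; [by []|by []|].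
have [k ks] := rot_rot_inv (find (mem S) s) s; rewrite -ks -/t.
have covt : cover (S |: P) \subset [set x in t].
  by have [/eqP-> _ _] := and3P part'; apply/subsetP=> x; rewrite !inE memt.
apply: noncrossing_rot => //; apply/noncrossingP=> B C a b c d.
have out D x y z : D \in P -> x \in D -> y \in D -> z \in S ->
    (index x t < index z t)%N -> (index z t < index y t)%N -> False.
  move=> DP xD yD zS xz zy.
  have := linked_in (arcwiseP _ _ _ (arcP D DP) x y xD yD) (ltnW xz) (ltnW zy).
  by rewrite inE zS.
move=> BQ CQ BC aB bC cB dC ab bc cd.
case/setU1P: BQ CQ => [BS|BP] /setU1P[CS|CP].
- by rewrite BS CS eqxx in BC.
- by apply: (out C b d c CP); rewrite // -BS.
- by apply: (out B a c b BP); rewrite // -CS.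
- exact: (ncP B C a b c d).
Qed.

End Cycles.

(** * A pointed noncrossing partition is determined by its graph *)

Section Components.
Variable V : finType.
Implicit Types (s t p q : seq V) (x y z u v : V) (e B C S : {set V}) (P : {set {set V}}).

Lemma mult_restr_gt0 (g : mgraph V) S e :
  (0 < mult (restr g S) e)%N -> e \subset S.
Proof. by rewrite ffunE; case: ifP. Qed.

Lemma mult_pnc_graph s S P e :
  mult (pnc_graph s (S, P)) e = (mult (restr (cycle_graph s) S) e +
    \sum_(B in P) mult (restr (contr (cycle_graph s) S) B) e)%N.
Proof. by rewrite [LHS]ffunE mult_big. Qed.

Definition block_graph s S B : mgraph V :=
  if B == S then restr (cycle_graph s) S else restr (contr (cycle_graph s) S) B.

Lemma PNC_partition s S P : (S, P) \in PNC s ->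
  S \notin P /\ partition (S |: P) [set x in s].
Proof. by rewrite inE => /and3P[]. Qed.

Lemma PNC_block_inj s S P B C x : (S, P) \in PNC s ->
  B \in S |: P -> C \in S |: P -> x \in B -> x \in C -> B = C.
Proof.
move=> /PNC_partition[_ /and3P[_ triv _]] BQ CQ xB xC.
apply/eqP; apply: contraLR xC => BC.
by rewrite (disjointFr (trivIsetP triv _ _ BQ CQ BC)).
Qed.

Lemma pnc_graph_block s S P B x e : (S, P) \in PNC s -> B \in S |: P ->
  x \in e -> e \subset B -> mult (pnc_graph s (S, P)) e = mult (block_graph s S B) e.
Proof.
move=> SPNC BQ xe /subsetP eB; have [SP _] := PNC_partition SPNC.
have zero D (g : mgraph V) : D \in S |: P -> D != B -> mult (restr g D) e = 0%N.
  move=> DQ; apply: contraNeq; rewrite -lt0n => /mult_restr_gt0/subsetP eD.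
  by apply/eqP/(PNC_block_inj SPNC DQ BQ (eD x xe) (eB x xe)).
rewrite mult_pnc_graph /block_graph; case: eqP BQ zero => [-> _ zero|/eqP BS BQ zero].
  rewrite big1 ?addn0 // => D DP; apply: zero; first exact: setU1r.
  by apply: contraNneq SP => <-.
rewrite zero ?setU11 //; last by rewrite eq_sym.
have BP : B \in P by move: BQ; rewrite in_setU1 (negPf BS).
rewrite (bigD1 B) //= big1 ?addn0 // => D /andP[DP DB].
by apply: zero => //; apply: setU1r.
Qed.

Lemma pnc_graph_edge s S P e : (S, P) \in PNC s ->
  (0 < mult (pnc_graph s (S, P)) e)%N -> exists2 B, B \in S |: P & e \subset B.
Proof.
move=> SPNC; rewrite mult_pnc_graph addn_gt0 => /orP[/mult_restr_gt0 eS|].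
  by exists S; rewrite ?setU11.
rewrite lt0n sum_nat_eq0 negb_forall => /existsP[B]; rewrite negb_imply -lt0n.
by case/andP=> BP /mult_restr_gt0 eB; exists B; rewrite // setU1r.
Qed.

Lemma adjacent_split t B (c : pred V) u v : u \in B -> v \in B -> c u -> ~~ c v ->
  (index u t < index v t)%N -> exists u' v',
    [/\ u' \in B, v' \in B, c u', ~~ c v' & (index u' t < index v' t)%N /\
        {in B, forall z, (index u' t < index z t)%N -> (index z t < index v' t)%N -> False}].
Proof.
move=> uB vB cu cv uv.
pose right_of z := [&& z \in B, ~~ c z & (index u t < index z t)%N].
have Pv : right_of v by rewrite /right_of vB cv.
(* [v'] is the first element after [u] that fails [c], and [u'] the last one before [v'] that
   satisfies it; an element of [B] between them would contradict one of the two choices. *)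
case: (@arg_minnP _ v right_of (fun z => index z t) Pv) => v' /and3P[v'B cv' uv'] minv'.
pose left_of z := [&& z \in B, c z & (index z t < index v' t)%N].
have Pu : left_of u by rewrite /left_of uB cu.
case: (@arg_maxnP _ u left_of (fun z => index z t) Pu) => u' /and3P[u'B cu' uv''] maxu'.
exists u', v'; split=> //; split=> // z zB u'z zv'.
have [cz|cz] := boolP (c z).
  by have := maxu' z; rewrite /left_of zB cz zv' => /(_ isT) /=; rewrite leqNgt u'z.
have uz : (index u t < index z t)%N.
  by apply: leq_ltn_trans u'z; apply: maxu'.
by have := minv' z; rewrite /right_of zB cz uz => /(_ isT) /=; rewrite leqNgt zv'.
Qed.

(** Stated for windows of the closed sequence, so that threads may use the closing edge;
    [lift_edges] takes care of double edges. *)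
Lemma cycle_thread s S x0 p (a b q : seq V) u v : uniq s -> cycle_graph (x0 :: p) = cycle_graph s ->
  uniq (x0 :: p) -> x0 :: rcons p x0 = a ++ (u :: rcons q v) ++ b -> uniq q ->
  {subset q <= [set x in s] :\: S} ->
  exists2 w : walk (cycle_graph s),
    is_thread (verts (cycle_graph s) :\: S) [set u; v] w & w.1 = u :: rcons q v :> seq V.
Proof.
move=> us Ec up split_p uq qT.
have [X [Y XY]] := path_edges_infix a b (rcons q v) u.
have [fs fsE ufs] : exists2 fs : seq (edge (cycle_graph s)),
    map tag fs = steps u (rcons q v) & uniq fs.
  apply: lift_edges => e; rewrite -Ec /= ffunE -[steps x0 _]/(path_edges (x0 :: rcons p x0)).
  by rewrite split_p XY !count_cat addnCA leq_addr.
have szp : (size (x0 :: p) <= #|V|)%N by rewrite -(card_uniqP up) max_card.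
have szE := congr1 size split_p.
(* A full turn repeats its first vertex, hence the bound [#|V|.+1]. *)
have sz1 : (size (u :: rcons q v) <= #|V|.+1)%N.
  by move: szE szp; rewrite !size_cat /= !size_rcons; clear => E1 E2; lia.
have sz2 : (size fs <= #|V|)%N.
  by rewrite -(size_map tag) fsE size_steps; move: sz1; rewrite /= ltnS.
exists (Bseq sz1, Bseq sz2) => //; rewrite /is_thread /= last_rcons belast_rcons /=.
rewrite eqxx fsE eqxx ufs uq -size_eq0 size_rcons /=.
by apply/allP=> z /qT.
Qed.

Lemma threads_gt0 (g : mgraph V) T e (w : walk g) : is_thread T e w -> (0 < #|threads g T e|)%N.
Proof.
move=> wT; rewrite card_gt0; apply/set0Pn; exists [set w; rev_walk w].
by apply/imsetP; exists w; rewrite // inE.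
Qed.

(** Connectedness of [B] is expressed by cuts: every [C] that separates [B] is crossed by an edge,
    namely a thread between two neighbouring elements of [B]. *)
Lemma pnc_block_connected s S P B C x y : uniq s -> (S, P) \in PNC s -> B \in S |: P ->
  x \in B -> y \in B -> x \in C -> y \notin C ->
  exists u v, [/\ u \in B, v \in B, u \in C, v \notin C &
    (0 < mult (pnc_graph s (S, P)) [set u; v])%N].
Proof.
move=> us SPNC BQ xB yB xC yC.
have mulE u v : u \in B -> v \in B ->
    mult (pnc_graph s (S, P)) [set u; v] = mult (block_graph s S B) [set u; v].
  move=> uB vB; apply: (pnc_graph_block (x := u) SPNC BQ); first exact: set21.
  by rewrite subUset !sub1set uB.
have := SPNC; rewrite PNCP // => /and3P[sSI S0 PNC].
have [BS|BS] := eqVneq B S; last first.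
  have BP : B \in P by move: BQ; rewrite in_setU1 (negPf BS).
  have [part _ arcP] := run_NCP _ _ _ PNC; have [/eqP cov _ _] := and3P part.
  set t := start_in S s in PNC arcP; set U := _ :\: S in PNC arcP cov.
  have ut : uniq t by rewrite rot_uniq.
  have sUt : U \subset [set x in t].
    by apply/subsetP=> z; rewrite !inE mem_rot => /andP[].
  have sBU : B \subset U by rewrite -cov; apply: bigcup_sup.
  have edge_gt0 u v : u \in B -> v \in B -> (index u t < index v t)%N ->
      {in B, forall z, (index u t < index z t)%N -> (index z t < index v t)%N -> False} ->
      (0 < mult (pnc_graph s (S, P)) [set u; v])%N.
    move=> uB vB uv btw; rewrite mulE // /block_graph (negPf BS) contr_cycle //.
    rewrite mult_restr_forest // lt0b; apply/consecutiveP; exists u, v; split=> // z uz zv.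
    rewrite inE; apply/andP; split; first by apply/negP=> zB; apply: btw zB uz zv.
    by apply: linked_in (arcwiseP _ _ _ (arcP B BP) u v uB vB) _ _; apply: ltnW.
  have [lt|lt|E] := ltngtP (index x t) (index y t).
  - have [u [v [uB vB uC vC [uv btw]]]] := adjacent_split xB yB xC yC lt.
    by exists u, v; split=> //; apply: edge_gt0.
  - have [|u [v [uB vB uC vC [uv btw]]]] := adjacent_split (c := predC (mem C)) yB xB yC _ lt.
      by rewrite /= xC.
    by exists v, u; split=> //; [move: vC; rewrite /= negbK|rewrite setUC; apply: edge_gt0].
  - have yt : y \in t by have := subsetP sUt y (subsetP sBU y yB); rewrite inE.
    by rewrite (index_eq yt E) (negPf yC) in xC.
rewrite BS in xB yB mulE *.
(* Starting the cycle at [x] puts [x] before [y], so that only one order has to be considered. *)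
have xI : [set x] \subset [set z in s] by rewrite sub1set; apply: (subsetP sSI).
have [|x' [p [/set1P-> tE]]] := start_in_cons xI; first by apply/set0Pn; exists x; rewrite inE.
have utp : uniq (x :: p) by rewrite -tE rot_uniq.
have Ec : cycle_graph (x :: p) = cycle_graph s by rewrite -tE cycle_graph_rot.
have memp z : (z \in x :: p) = (z \in s) by rewrite -tE mem_rot.
have xy : (index x (x :: p) < index y (x :: p))%N.
  by rewrite /= eqxx; case: eqP => // E; rewrite -E xC in yC.
have [u [v [uS vS uC vC [uv btw]]]] := adjacent_split xB yB xC yC xy.
exists u, v; split=> //.
have vp : v \in x :: p by rewrite memp; have := subsetP sSI v vS; rewrite inE.
have [a [q [b pE]]] := split_between utp vp uv.
rewrite mulE // /block_graph eqxx ffunE subUset !sub1set uS vS /=.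
have qT : {subset q <= [set x in s] :\: S}.
  move=> z zq; have := zq; have utp' := utp; rewrite pE in utp'.
  rewrite (mem_between z utp') -pE => /andP[uz zv]; rewrite !inE.
  apply/andP; split; first by apply/negP=> zS; apply: btw zS uz zv.
  by rewrite -memp pE !mem_cat inE mem_rcons inE zq !orbT.
have uq : uniq q.
  move: utp; rewrite pE !cat_uniq => /and3P[_ _ /and3P[]].
  by rewrite /= rcons_uniq => /and3P[].
have [|w wT _] := @cycle_thread s S x p a (rcons b x) q u v us Ec utp _ uq qT.
  by rewrite -rcons_cons pE !rcons_cat.
exact: threads_gt0 wT.
Qed.

(** If [B] met [C] without being contained in it, an edge of the common graph would leave [C], while
    every edge of the second graph stays inside a block. *)
Lemma pnc_blocks_sub s S P S' P' : uniq s -> (S, P) \in PNC s -> (S', P') \in PNC s ->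
  pnc_graph s (S, P) = pnc_graph s (S', P') -> S |: P \subset S' |: P'.
Proof.
move=> us pPNC p'PNC Eg.
have half (S1 S2 : {set V}) (P1 P2 : {set {set V}}) B C x : (S1, P1) \in PNC s -> (S2, P2) \in PNC s ->
    pnc_graph s (S1, P1) = pnc_graph s (S2, P2) -> B \in S1 |: P1 -> C \in S2 |: P2 ->
    x \in B -> x \in C -> B \subset C.
  move=> p1 p2 E BQ CQ xB xC; apply/subsetP=> y yB; apply: contraT => yC.
  have [u [v [uB vB uC vC]]] := pnc_block_connected us p1 BQ xB yB xC yC.
  rewrite E => /(pnc_graph_edge p2)[D DQ]; rewrite subUset !sub1set => /andP[uD vD].
  by rewrite -(PNC_block_inj p2 DQ CQ uD uC) vD in vC.
apply/subsetP=> B BQ; have [_ /and3P[/eqP cov _ Q0]] := PNC_partition pPNC.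
have [_ /and3P[/eqP cov' _ _]] := PNC_partition p'PNC.
have /set0Pn[x xB] : B != set0 by apply: contraNneq Q0 => <-.
have: x \in cover (S' |: P') by rewrite cov' -cov; apply/bigcupP; exists B.
case/bigcupP=> C CQ xC; suff -> : B = C by [].
by apply/eqP; rewrite eqEsubset (half S S' P P' B C x) // (half S' S P' P C B x).
Qed.

Lemma threads_gt1 (g : mgraph V) T e (w w' : walk g) z :
  is_thread T e w -> is_thread T e w' -> z \in (w.1 : seq V) -> z \notin (w'.1 : seq V) ->
  (1 < #|threads g T e|)%N.
Proof.
move=> wT w'T zw zw'; pose W (k : walk g) := [set k; rev_walk k].
have inT (k : walk g) : is_thread T e k -> W k \in threads g T e.
  by move=> kT; apply/imsetP; exists k; rewrite // inE.
have ne : W w != W w'.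
  apply: contraTneq zw => E; have: w \in W w' by rewrite -E set21.
  by rewrite !inE => /orP[]/eqP->; rewrite //= mem_rev.
have <- : #|[set W w; W w']| = 2%N by rewrite cards2 ne.
by apply: subset_leq_card; rewrite subUset !sub1set !inT.
Qed.

(* Were S a path component of the second graph, its ends would be joined in  *)
(* the first one by a thread that passes through S', and then by a second    *)
(* one that does not.                                                        *)
Lemma pnc_zero_block s S P S' P' : uniq s -> (S, P) \in PNC s -> (S', P') \in PNC s ->
  pnc_graph s (S, P) = pnc_graph s (S', P') -> S \notin P'.
Proof.
move=> us pPNC p'PNC Eg; apply/negP=> SP'.
have SS' : S' != S by apply: contraTneq SP' => <-; have [] := PNC_partition p'PNC.
have SQ' : S \in S' |: P' by apply: setU1r.
have := pPNC; rewrite PNCP // => /and3P[sSI S0 _].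
have := p'PNC; rewrite PNCP // => /and3P[sS'I S'0 P'NC].
have [z0 [p [z0S' tE]]] := start_in_cons sS'I S'0; set t := start_in S' s in tE P'NC.
have z0S : z0 \notin S.
  by apply: contra SS' => z0S; apply/eqP/(PNC_block_inj p'PNC (setU11 _ _) SQ' z0S').
have ut : uniq t by rewrite rot_uniq.
have memt z : (z \in t) = (z \in s) by rewrite mem_rot.
have Sin z : z \in S -> z \in t by move=> zS; have := subsetP sSI z zS; rewrite inE memt.
(* Inside [S] the two graphs agree, and in the second one [S] is a block of a forest, so all
   multiplicities there are at most 1. *)
have multE e u : u \in e -> e \subset S -> mult (restr (cycle_graph s) S) e =
    consecutive t ([set x in s] :\: S' :\: S) S e :> nat.
  move=> ue eS; rewrite -mult_restr_forest //; first last.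
  - apply/subsetP=> z zS; rewrite inE (subsetP sSI) // andbT; apply/negP=> zS'.
    by rewrite (PNC_block_inj p'PNC (setU11 _ _) SQ' zS' zS) eqxx in SS'.
  - by apply/subsetP=> z; rewrite !inE memt => /andP[].
  rewrite -contr_cycle //.
  have := pnc_graph_block pPNC (setU11 S P) ue eS; rewrite Eg.
  by rewrite (pnc_graph_block p'PNC SQ' ue eS) /block_graph eqxx eq_sym (negPf SS').
have split_first (l : seq V) : has (mem S) l ->
    exists l1 x l2, [/\ l = l1 ++ x :: l2, x \in S & {in l1, forall z, z \notin S}].
  elim: l => //= z l IHl; have [zS _|zS /IHl[l1 [x [l2 [-> xS l1S]]]]] := boolP (z \in S).
    by exists [::], z, l.
  exists (z :: l1), x, l2; split=> // z'; rewrite inE => /orP[/eqP->//|]; exact: l1S.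
have /set0Pn[s0 s0S] := S0.
(* [y] is the last element of [S] in [t]; [x] below is the first one. *)
have [|B' [y [A' [revE yS B'S]]]] := split_first (rev t).
  by apply/hasP; exists s0; rewrite //= mem_rev Sin.
pose B := rev B'; pose A := rev A'.
have tAB : t = A ++ y :: B.
  by rewrite -[t]revK revE rev_cat rev_cons cat_rcons.
have BS z : z \in B -> z \notin S by rewrite mem_rev; apply: B'S.
have [|A1 [x [A2 [AE xS A1S]]]] := split_first (rcons A y).
  by apply/hasP; exists y; rewrite // mem_rcons mem_head.
have z0A1 : z0 \in A1.
  have: t = A1 ++ x :: A2 ++ B by rewrite tAB -cat_rcons AE -catA.
  rewrite tE; case: (A1) => [|z A3] [z0E _]; last by rewrite z0E mem_head.
  by rewrite z0E xS in z0S.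
have rotE : rot (size A) t = y :: B ++ A by rewrite tAB rot_size_cat.
have uyBA : uniq (y :: B ++ A) by rewrite -rotE rot_uniq.
have cycE : cycle_graph (y :: B ++ A) = cycle_graph s.
  by rewrite -rotE !cycle_graph_rot.
have inner_in (l : seq V) : {subset l <= t} -> {in l, forall z, z \notin S} ->
    {subset l <= [set z in s] :\: S}.
  by move=> lt lS z zl; rewrite !inE lS // -memt lt.
have subBA1 : {subset B ++ A1 <= y :: B ++ A}.
  have sA : {subset A1 <= rcons A y} by move=> z zA1; rewrite AE mem_cat zA1.
  move=> z; rewrite mem_cat => /orP[zB|/sA]; first by rewrite inE mem_cat zB orbT.
  by rewrite mem_rcons !inE mem_cat => /orP[->|->]; rewrite ?orbT.
(* [w2] leaves [y], passes the end of [t] and the vertex [z0] of [S'], and arrives at [x]. *)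
have [|||w2 w2T w2E] := @cycle_thread s S y (B ++ A) [::] A2 (B ++ A1) y x us cycE uyBA.
- by rewrite /= rcons_cat AE cat_rcons -catA.
- rewrite uniq_catC; move: ut; rewrite tAB -cat_rcons AE -catA !cat_uniq.
  case/and3P=> uA1 /hasPn disj; rewrite /= => /and3P[_ _ uB].
  rewrite uA1 uB andbT /=; apply/hasPn=> z zB; apply: disj.
  by rewrite inE mem_cat zB !orbT.
- apply: inner_in => z; first by move/subBA1; rewrite -rotE mem_rot.
  by rewrite mem_cat => /orP[/BS|/A1S].
have yxS : [set y; x] \subset S by rewrite subUset !sub1set yS.
have multyx := multE [set y; x] y (set21 y x) yxS.
have c1 : consecutive t ([set x in s] :\: S' :\: S) S [set y; x].
  have: (0 < mult (restr (cycle_graph s) S) [set y; x])%N.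
    by rewrite ffunE yxS; apply: threads_gt0 w2T.
  by rewrite multyx lt0b.
(* The same ends are also consecutive along [t], so a second thread [w1] joins them without passing
   through [z0]; this makes the multiplicity at least 2. *)
case/consecutiveP: (c1) => a [b [aS bS Eab ab btw]].
have [A3 [q [B3 tE3]]] := split_between ut (Sin b bS) ab.
have cycE' : cycle_graph (z0 :: p) = cycle_graph s by rewrite -tE cycle_graph_rot.
have utE : uniq (z0 :: p) by rewrite -tE.
have qbtw z : z \in q -> (index a t < index z t < index b t)%N.
  by move=> zq; have := zq; have ut' := ut; rewrite tE3 in ut'; rewrite (mem_between z ut') -tE3.
have [|||w1 w1T w1E] := @cycle_thread s S z0 p A3 (rcons B3 z0) q a b us cycE' utE.
- by rewrite -rcons_cons -tE tE3 !rcons_cat.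
- move: ut; rewrite tE3 !cat_uniq => /and3P[_ _ /and3P[]].
  by rewrite /= rcons_uniq => /and3P[].
- move=> z /qbtw/andP[az zb]; have := btw z az zb.
  by rewrite !inE => /and3P[-> _ ->].
have z0t : index z0 t = 0%N by rewrite tE /= eqxx.
have z0w1 : z0 \notin (w1.1 : seq V).
  rewrite w1E inE mem_rcons inE !negb_or.
  apply/and3P; split; [by apply: contraNneq z0S => ->|by apply: contraNneq z0S => ->|].
  by apply/negP=> /qbtw; rewrite z0t ltn0.
have z0w2 : z0 \in (w2.1 : seq V) by rewrite w2E inE mem_rcons inE mem_cat z0A1 !orbT.
rewrite -Eab in w1T; have := threads_gt1 w2T w1T z0w2 z0w1.
by have := multyx; rewrite ffunE yxS c1 => ->.
Qed.

Lemma pnc_graph_inj s : uniq s -> {in PNC s &, injective (@pnc_graph V s)}.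
Proof.
move=> us [S P] [S' P'] pPNC p'PNC Eg.
have EQ : S |: P = S' |: P'.
  by apply/eqP; rewrite eqEsubset !(pnc_blocks_sub us _ _ _).
have SS' : S = S'.
  have := setU11 S P; rewrite EQ in_setU1 (negPf (pnc_zero_block us pPNC p'PNC Eg)) orbF.
  by move/eqP.
have [SP _] := PNC_partition pPNC; have [SP' _] := PNC_partition p'PNC.
by rewrite SS' in SP EQ *; rewrite -(setU1K SP) EQ setU1K.
Qed.

End Components.

(** * The expansion for the cycle *)

Lemma inC_cycle (V : finType) (s : seq V) : s != [::] -> uniq s ->
  inC [set x in s] (cycle_graph s).
Proof.
move=> s0 us; exists [:: (true, s)]; split=> /=; rewrite ?cats0 ?s0 //.
by rewrite big_seq1.
Qed.

(** The additional sign is that of the first step of the recursion. *)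
Lemma pnc_coef_weight (V : finType) (s : seq V) (S : {set V}) P :
  pnc_coef s (S, P) = - weight (start_in S s) P.
Proof. by rewrite /pnc_coef exprD expr1 mulN1r mulNr. Qed.

Lemma pnc_coef_neq0 (V : finType) (s : seq V) p : pnc_coef s p != 0.
Proof.
rewrite mulf_neq0 ?signr_eq0 // eqz_nat -lt0n.
by apply: prodn_gt0 => B; apply: catalan_gt0.
Qed.

Lemma malgU_pnc_graph (K : fieldType) (V : finType) (s : seq V) (S : {set V}) P :
  << pnc_graph s (S, P) >> = << restr (cycle_graph s) S >> *
    \prod_(B in P) << restr (contr (cycle_graph s) S) B >> :> {malg K[mgraph V]}.
Proof. by rewrite [LHS]malgU_mul; apply: (congr1 (GRing.mul _)); apply: malgU_big. Qed.

Theorem theorem3p10 (K : fieldType) (V : finType)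
  (A : {set V} -> {linear {malg K[mgraph V]} -> {malg K[mgraph V]}})
  (antipodeA : is_antipode A)
  (s : seq V) (s_neq0 : s != [::]) (s_uniq : uniq s) :
  [/\ A [set x in s] << cycle_graph s >> =
        \sum_(p in PNC s) (pnc_coef s p)%:~R *: << pnc_graph s p >>,
      cancellation_free (PNC s) (pnc_coef s) (pnc_graph s)
    & grouping_free (PNC s) (pnc_coef s) (pnc_graph s)].
Proof.
split; first last.
- split; first by move=> p _; apply: pnc_coef_neq0.
  exact: pnc_graph_inj.
(* Equal graphs have equal indices, so the product of the coefficients is a square. *)
- by move=> p p' pPNC p'PNC /(pnc_graph_inj s_uniq pPNC p'PNC)->; rewrite -expr2 Num.Theory.sqr_ge0.
pose I := [set x in s].
have I0 : I != set0.
  by case: (s) s_neq0 @I => // x p _; apply/set0Pn; exists x; rewrite inE mem_head.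
have [_ AI] := antipodeA.
rewrite (AI I _ I0 (inC_cycle s_neq0 s_uniq)) -sumrN.
(* The first step of the recursion removes the zero block [S], and [forest_antipode] then partitions
   the rest into the nonzero blocks. *)
transitivity (\sum_(S : {set V} | (S \subset I) && (S != set0))
    \sum_(P in run_NC (start_in S s) (I :\: S))
      (pnc_coef s (S, P))%:~R *: << pnc_graph s (S, P) >> : {malg K[mgraph V]}).
  apply: eq_bigr => S /andP[sSI S0].
  have sUt : I :\: S \subset [set x in start_in S s].
    by apply/subsetP=> x; rewrite !inE mem_rot => /andP[].
  have ut : uniq (start_in S s) by rewrite rot_uniq.
  rewrite (contr_cycle s_uniq sSI S0) (forest_antipode antipodeA ut sUt).
  rewrite mulr_sumZr -sumrN; apply: eq_bigr => P _.
  rewrite -scaleNr pnc_coef_weight rmorphN malgU_pnc_graph.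
  by rewrite (contr_cycle s_uniq sSI S0).
rewrite pair_big_dep; apply: eq_big => [[S P]|[S P] _]; last by [].
by rewrite PNCP // andbA.
Qed.
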